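(* Let $R\subseteq\{e,c,o\}$. The provability problem for $\mathbf{NACILL}^0_R$ is undecidable: there is no algorithm deciding, for an arbitrary sequent $s$, whether $s$ is provable in $\mathbf{NACILL}^0_R$.
   Context: Formulas: terms over a countably infinite set of variables in $\{\wedge,\vee,\cdot,\backslash,/,!,1,0\}$. Structures: elements of the free unital groupoid $(Fm^\circ,\circ,\varepsilon)$ generated by formulas ($\circ$ non-associative, $\varepsilon$ empty structure and unit). $k$ ranges over structures in the free unital groupoid generated by formulas $!a$ (including $\varepsilon$). A context $u$ is a structure with exactly one hole; $u(x)$ fills it with $x$. A sequent is $x\Rightarrow\delta$, $x$ a structure, $\delta$ a formula or the empty stoup $\epsilon$. $\mathbf{NACILL}^0$: initial sequents $a\Rightarrow a$, $\varepsilon\Rightarrow 1$, $0\Rightarrow\epsilon$; rules (premises / conclusion): (cut) $x\Rightarrow a$, $u(a)\Rightarrow\delta$ / $u(x)\Rightarrow\delta$; $(1\Rightarrow)$ $u(\varepsilon)\Rightarrow\delta$ / $u(1)\Rightarrow\delta$; $(\Rightarrow 0)$ $x\Rightarrow\epsilon$ / $x\Rightarrow 0$; $(\backslash\Rightarrow)$ $x\Rightarrow a$, $u(b)\Rightarrow\delta$ / $u(x\circ(a\backslash b))\Rightarrow\delta$; $(\Rightarrow\backslash)$ $a\circ x\Rightarrow b$ / $x\Rightarrow a\backslash b$; $(/\Rightarrow)$ $x\Rightarrow a$, $u(b)\Rightarrow\delta$ / $u((b/a)\circ x)\Rightarrow\delta$; $(\Rightarrow/)$ $x\circ a\Rightarrow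 b$ / $x\Rightarrow b/a$; $(\cdot\Rightarrow)$ $u(a\circ b)\Rightarrow\delta$ / $u(a\cdot b)\Rightarrow\delta$; $(\Rightarrow\cdot)$ $x\Rightarrow a$, $y\Rightarrow b$ / $x\circ y\Rightarrow a\cdot b$; $(\wedge\Rightarrow)$ $u(a_i)\Rightarrow\delta$ / $u(a_1\wedge a_2)\Rightarrow\delta$; $(\Rightarrow\wedge)$ $x\Rightarrow a$, $x\Rightarrow b$ / $x\Rightarrow a\wedge b$; $(\vee\Rightarrow)$ $u(a)\Rightarrow\delta$, $u(b)\Rightarrow\delta$ / $u(a\vee b)\Rightarrow\delta$; $(\Rightarrow\vee)$ $x\Rightarrow a_i$ / $x\Rightarrow a_1\vee a_2$; $(!\Rightarrow)$ $u(a)\Rightarrow\delta$ / $u(!a)\Rightarrow\delta$; $(\Rightarrow!)$ $k\Rightarrow a$ / $k\Rightarrow !a$; $(kw)$ $u(\varepsilon)\Rightarrow\delta$ / $u(k)\Rightarrow\delta$; $(kc)$ $u(k\circ k)\Rightarrow\delta$ / $u(k)\Rightarrow\delta$; two-directional: $(ke)$ $u(k\circ y)\Rightarrow\delta\leftrightarrow u(y\circ k)\Rightarrow\delta$; $(ka1)$ $u((k\circ y)\circ z)\Rightarrow\delta\leftrightarrow u(k\circ(y\circ z))\Rightarrow\delta$; $(ka2)$ $u((x\circ y)\circ k)\Rightarrow\delta\leftrightarrow u(x\circ(y\circ k))\Rightarrow\delta$. Structural rules: $(e)$ $u(x\circ y)\Rightarrow\delta$ / $u(y\circ x)\Rightarrow\delta$;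 $(c)$ $u(x\circ x)\Rightarrow\delta$ / $u(x)\Rightarrow\delta$; $(o)$ $x\Rightarrow\epsilon$ / $x\Rightarrow a$. $\mathbf{NACILL}^0_R$ is $\mathbf{NACILL}^0$ plus the rules in $R$; a sequent is provable if it has a derivation whose leaves are initial sequents. *)

(* Defs.v *)
From Stdlib Require Import List Arith.
Import ListNotations.

Inductive fm : Type :=
| Var  : nat -> fm
| And  : fm -> fm -> fm
| Or   : fm -> fm -> fm
| Mul  : fm -> fm -> fm
| LDiv : fm -> fm -> fm          (* a \ b  (LDiv a b) *)
| RDiv : fm -> fm -> fm          (* b / a  (RDiv b a) *)
| Bang : fm -> fm
| One  : fm
| Zero : fm.

(* ---------- Structures: the free unital groupoid generated by formulas.
   Elements are either the unit eps (None) or a nonempty binary tree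
   (Some t) of formulas; composition absorbs the unit. ---------- *)
Inductive tree : Type :=
| Leaf : fm -> tree
| Node : tree -> tree -> tree.

Definition st := option tree.
Definition eps : st := None.
Definition F (a : fm) : st := Some (Leaf a).

Definition comp (x y : st) : st :=
  match x, y with
  | None, _ => y
  | _, None => x
  | Some s, Some t => Some (Node s t)
  end.

Fixpoint bang_tree (t : tree) : Prop :=
  match t with
  | Leaf (Bang _) => True
  | Leaf _ => False
  | Node s u => bang_tree s /\ bang_tree u
  end.
Definition is_k (k : st) : Prop :=
  match k with None => True | Some t => bang_tree t end.

Inductive ctx : Type :=
| Hole : ctx
| CL : ctx -> st -> ctx
| CR : st -> ctx -> ctx.

Fixpoint fill (u : ctx) (x : st) : st :=
  match u with
  | Hole => x
  | CL u' y => comp (fill u' x) y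
  | CR y u' => comp y (fill u' x)
  end.

Definition stoup := option fm.

Inductive srule : Type := Rexch | Rcontr | Rweak_right.

Inductive prov (R : srule -> Prop) : st -> stoup -> Prop :=
| ax_id a : prov R (F a) (Some a)
| ax_one : prov R eps (Some One)
| ax_zero : prov R (F Zero) None
| r_cut u x a d : prov R x (Some a) -> prov R (fill u (F a)) d -> prov R (fill u x) d
| r_oneL u d : prov R (fill u eps) d -> prov R (fill u (F One)) d
| r_zeroR x : prov R x None -> prov R x (Some Zero)
| r_ldivL u x a b d : prov R x (Some a) -> prov R (fill u (F b)) d ->
    prov R (fill u (comp x (F (LDiv a b)))) d
| r_ldivR x a b : prov R (comp (F a) x) (Some b) -> prov R x (Some (LDiv a b))
| r_rdivL u x a b d : prov R x (Some a) -> prov R (fill u (F b)) d ->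
    prov R (fill u (comp (F (RDiv b a)) x)) d
| r_rdivR x a b : prov R (comp x (F a)) (Some b) -> prov R x (Some (RDiv b a))
| r_mulL u a b d : prov R (fill u (comp (F a) (F b))) d -> prov R (fill u (F (Mul a b))) d
| r_mulR x y a b : prov R x (Some a) -> prov R y (Some b) -> prov R (comp x y) (Some (Mul a b))
| r_andL1 u a b d : prov R (fill u (F a)) d -> prov R (fill u (F (And a b))) d
| r_andL2 u a b d : prov R (fill u (F b)) d -> prov R (fill u (F (And a b))) d
| r_andR x a b : prov R x (Some a) -> prov R x (Some b) -> prov R x (Some (And a b))
| r_orL u a b d : prov R (fill u (F a)) d -> prov R (fill u (F b)) d -> prov R (fill u (F (Or a b))) d
| r_orR1 x a b : prov R x (Some a) -> prov R x (Some (Or a b))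
| r_orR2 x a b : prov R x (Some b) -> prov R x (Some (Or a b))
| r_bangL u a d : prov R (fill u (F a)) d -> prov R (fill u (F (Bang a))) d
| r_bangR k a : is_k k -> prov R k (Some a) -> prov R k (Some (Bang a))
| r_kw u k d : is_k k -> prov R (fill u eps) d -> prov R (fill u k) d
| r_kc u k d : is_k k -> prov R (fill u (comp k k)) d -> prov R (fill u k) d
| r_ke1 u k y d : is_k k -> prov R (fill u (comp k y)) d -> prov R (fill u (comp y k)) d
| r_ke2 u k y d : is_k k -> prov R (fill u (comp y k)) d -> prov R (fill u (comp k y)) d
| r_ka1a u k y z d : is_k k -> prov R (fill u (comp (comp k y) z)) d ->
    prov R (fill u (comp k (comp y z))) d
| r_ka1b u k y z d : is_k k -> prov R (fill u (comp k (comp y z))) d ->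
    prov R (fill u (comp (comp k y) z)) d
| r_ka2a u k x y d : is_k k -> prov R (fill u (comp (comp x y) k)) d ->
    prov R (fill u (comp x (comp y k))) d
| r_ka2b u k x y d : is_k k -> prov R (fill u (comp x (comp y k))) d ->
    prov R (fill u (comp (comp x y) k)) d
| r_e u x y d : R Rexch -> prov R (fill u (comp x y)) d -> prov R (fill u (comp y x)) d
| r_c u x d : R Rcontr -> prov R (fill u (comp x x)) d -> prov R (fill u x) d
| r_o x a : R Rweak_right -> prov R x None -> prov R x (Some a).

Definition sequent := (st * stoup)%type.
Definition provable (R : srule -> Prop) (s : sequent) : Prop := prov R (fst s) (snd s).

Definition cpair (a b : nat) : nat := (a + b) * (a + b + 1) / 2 + b.

Fixpoint code_fm (a : fm) : nat :=
  match a with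
  | Var n => cpair 0 n
  | And a b => cpair 1 (cpair (code_fm a) (code_fm b))
  | Or a b => cpair 2 (cpair (code_fm a) (code_fm b))
  | Mul a b => cpair 3 (cpair (code_fm a) (code_fm b))
  | LDiv a b => cpair 4 (cpair (code_fm a) (code_fm b))
  | RDiv a b => cpair 5 (cpair (code_fm a) (code_fm b))
  | Bang a => cpair 6 (code_fm a)
  | One => cpair 7 0
  | Zero => cpair 8 0
  end.

Fixpoint code_tree (t : tree) : nat :=
  match t with
  | Leaf a => cpair 0 (code_fm a)
  | Node s u => cpair 1 (cpair (code_tree s) (code_tree u))
  end.

Definition code_st (x : st) : nat :=
  match x with None => 0 | Some t => S (code_tree t) end.
Definition code_stoup (d : stoup) : nat :=
  match d with None => 0 | Some a => S (code_fm a) end.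
Definition code_seq (s : sequent) : nat := cpair (code_st (fst s)) (code_stoup (snd s)).

Inductive instr : Type :=
| INC : nat -> instr
| DEC : nat -> nat -> instr.

Definition program := list instr.
Definition config := (nat * (nat -> nat))%type.

Definition upd (g : nat -> nat) (r v : nat) : nat -> nat :=
  fun i => if Nat.eqb i r then v else g i.

Definition step (P : program) (c : config) : config :=
  let (pc, g) := c in
  match nth_error P pc with
  | None => c
  | Some (INC r) => (S pc, upd g r (S (g r)))
  | Some (DEC r j) =>
      match g r with
      | 0 => (j, g)
      | S v => (S pc, upd g r v)
      end
  end.

Definition halted (P : program) (c : config) : Prop := length P <= fst c.

Definition init (n : nat) : config := (0, fun i => if Nat.eqb i 0 then n else 0).

Definition computes (P : program) (n m : nat) : Prop :=
  exists k, halted P (Nat.iter k (step P) (init n)) /\ snd (Nat.iter k (step P) (init n)) 0 = m.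

Definition decides (P : program) (Q : sequent -> Prop) : Prop :=
  forall s, (Q s -> computes P (code_seq s) 1) /\ (~ Q s -> computes P (code_seq s) 0).

(* Main.v *)
From Stdlib Require Import List Arith Lia Permutation FunctionalExtensionality.
Require Import Defs.
Import ListNotations.

(** A formula [!theta] on the left can be copied and moved to every place of the
    structure, so it acts as a theory: if [a \ b] is a conjunct of [theta], then
    [u(a) => ok] may be replaced by [u(b) => ok], and if [a \ (b v c)] is one, by the
    two sequents [u(b) => ok] and [u(c) => ok]. These are ground rewriting steps with
    universal branching on binary trees. A counter machine configuration is the tree
    [((q o C_1) o ...) o C_0], where the register [C_i = x_i o (x_i o ... o idle_i)]
    can be modified only at its innermost leaf. The control [q] and the register are
    too far apart to be rewritten together, and are synchronised by the branching:
    every move of one of them creates a second branch in which the moving component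
    is destroyed while the other one has to show that it is in the expected state.

    Soundness of the encoding is proved for all rule sets at once, in a closure
    semantics over a groupoid that validates (e), (c) and (o). Contraction is harmless
    because an acceptable configuration never contains the same component twice.

    For undecidability, suppose that [P] decides provability. Let [D] on input [n]
    compute the code of the sequent [A o (start o numeral n) => ok] in which [A] is the
    formula with code [n], run [P] on it, and halt iff [P] answers 0. If [n] is the code
    of the formula of [D] itself, then the sequent is provable iff [D] halts on [n] iff
    [P] answers that the sequent is not provable. *)

(** * Closure semantics *)

Section ClosureSemantics.

Variable W : Type.
Variable one : W.
Variable mul : W -> W -> W.
Hypothesis one_mul : forall x, mul one x = x.
Hypothesis mul_one : forall x, mul x one = x.

Inductive mctx : Type :=
| WHole : mctx
| WL : mctx -> W -> mctx
| WR : W -> mctx -> mctx.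

Fixpoint mfill (c : mctx) (x : W) : W :=
  match c with
  | WHole => x
  | WL c y => mul (mfill c x) y
  | WR y c => mul y (mfill c x)
  end.

Fixpoint wcomp (c d : mctx) : mctx :=
  match c with
  | WHole => d
  | WL c y => WL (wcomp c d) y
  | WR y c => WR y (wcomp c d)
  end.

Lemma mfill_wcomp c d x : mfill (wcomp c d) x = mfill c (mfill d x).
Proof. induction c; simpl; congruence. Qed.

Variable Acc : W -> Prop.
Hypothesis Acc_exchange :
  forall c x y, Acc (mfill c (mul x y)) -> Acc (mfill c (mul y x)).
Hypothesis Acc_contraction :
  forall c x, Acc (mfill c (mul x x)) -> Acc (mfill c x).

(** The closure operator of the polarity between elements and one-hole contexts. Whole contexts
    serve as tests because the product need not be associative. *)
Definition cl (S : W -> Prop) (x : W) : Prop :=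
  forall c, (forall s, S s -> Acc (mfill c s)) -> Acc (mfill c x).

Definition closed (S : W -> Prop) : Prop := forall x, cl S x -> S x.

Lemma cl_incl (S : W -> Prop) x : S x -> cl S x.
Proof. intros H c Hc. auto. Qed.

(** A context testing [T], composed with [c], is a context testing [S]. Hence [cl] is compatible
    with products, like a nucleus. *)
Lemma cl_mfill (S T : W -> Prop) c x :
  cl S x -> (forall s, S s -> cl T (mfill c s)) -> cl T (mfill c x).
Proof.
  intros Hx H d Hd. rewrite <- mfill_wcomp. apply Hx.
  intros s Hs. rewrite mfill_wcomp. apply H; auto.
Qed.

Lemma cl_bind (S T : W -> Prop) x :
  cl S x -> (forall s, S s -> cl T s) -> cl T x.
Proof. intros Hx H. apply (cl_mfill S T WHole x Hx H). Qed.

Lemma closed_cl S : closed (cl S).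
Proof. intros x Hx. apply (cl_bind _ _ _ Hx). auto. Qed.

Lemma closed_mfill (S T : W -> Prop) c x :
  closed T -> cl S x -> (forall s, S s -> T (mfill c s)) -> T (mfill c x).
Proof.
  intros HT Hx H. apply HT. apply (cl_mfill S); auto.
  intros s Hs. apply cl_incl; auto.
Qed.

Lemma closed_Acc : closed Acc.
Proof. intros x Hx. apply (Hx WHole). auto. Qed.

Definition set_mul (S T : W -> Prop) (z : W) : Prop :=
  exists x y, S x /\ T y /\ z = mul x y.

Lemma cl_mul (S T U : W -> Prop) x y :
  cl S x -> cl T y -> (forall s t, S s -> T t -> cl U (mul s t)) ->
  cl U (mul x y).
Proof.
  intros Hx Hy H. apply (cl_mfill S U (WL WHole y) x Hx).
  intros s Hs. apply (cl_mfill T U (WR s WHole) y Hy).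
  intros t Ht. apply H; auto.
Qed.

(** * Interpretation of formulas and structures *)

Variable v : nat -> W -> Prop.

(** A formula [Bang a] denotes the closure of [{one}] or of the empty set, according to whether
    [one] lies in [sem a]. It thus behaves like the unit, as the rules for [k] demand. *)
Fixpoint sem (a : fm) : W -> Prop :=
  match a with
  | Var n => cl (v n)
  | And a b => fun x => sem a x /\ sem b x
  | Or a b => cl (fun x => sem a x \/ sem b x)
  | Mul a b => cl (set_mul (sem a) (sem b))
  | LDiv a b => fun x => forall y, sem a y -> sem b (mul y x)
  | RDiv b a => fun x => forall y, sem a y -> sem b (mul x y)
  | Bang a => cl (fun x => x = one /\ sem a one)
  | One => cl (fun x => x = one)
  | Zero => cl (fun _ => False)
  end.

Lemma closed_sem a : closed (sem a).
Proof.
  induction a as [n|a IHa b IHb|a IHa b IHb|a IHa b IHb|a IHa b IHb|b IHb a IHa|a IHa| |];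
    simpl; try apply closed_cl.
  - intros x Hx. split; [apply IHa|apply IHb];
      apply (cl_bind _ _ _ Hx); intros s [Ha Hb]; apply cl_incl; auto.
  - intros x Hx y Hy. apply (closed_mfill _ _ (WR y WHole) x IHb Hx).
    intros s Hs. apply Hs; auto.
  - intros x Hx y Hy. apply (closed_mfill _ _ (WL WHole y) x IHb Hx).
    intros s Hs. apply Hs; auto.
Qed.

(** Products of structures are left unclosed, so that an element of a filled context literally
    splits into a context of elements and an element in its hole. *)
Fixpoint sem_tree (t : tree) : W -> Prop :=
  match t with
  | Leaf a => sem a
  | Node s u => set_mul (sem_tree s) (sem_tree u)
  end.

Definition sem_st (x : st) : W -> Prop :=
  match x with None => fun z => z = one | Some t => sem_tree t end.

(* The empty stoup is interpreted by the least closed set, which validates (o). *)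
Definition sem_stoup (d : stoup) : W -> Prop :=
  match d with None => cl (fun _ => False) | Some a => sem a end.

Lemma closed_sem_stoup d : closed (sem_stoup d).
Proof. destruct d; [apply closed_sem|apply closed_cl]. Qed.

Lemma sem_comp x y z : sem_st (comp x y) z <-> set_mul (sem_st x) (sem_st y) z.
Proof.
  unfold set_mul. destruct x as [s|], y as [t|]; simpl.
  - reflexivity.
  - split; [intros H; exists z, one; auto|].
    intros (a & b & Ha & -> & ->). rewrite mul_one. auto.
  - split; [intros H; exists one, z; auto|].
    intros (a & b & -> & Hb & ->). rewrite one_mul. auto.
  - split; [intros ->; exists one, one; auto|].
    intros (a & b & -> & -> & ->). auto.
Qed.

Lemma sem_comp_mul x y a b :
  sem_st x a -> sem_st y b -> sem_st (comp x y) (mul a b).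
Proof. intros. apply sem_comp. exists a, b; auto. Qed.

Lemma sem_comp_inv x y z : sem_st (comp x y) z ->
  exists a b, sem_st x a /\ sem_st y b /\ z = mul a b.
Proof. apply sem_comp. Qed.

Lemma sem_fill u x z : sem_st (fill u x) z ->
  exists c s, sem_st x s /\ z = mfill c s /\
    forall y t, sem_st y t -> sem_st (fill u y) (mfill c t).
Proof.
  revert z. induction u as [|u IH y|y u IH]; simpl; intros z Hz.
  - exists WHole, z. auto.
  - apply sem_comp_inv in Hz. destruct Hz as (a & b & Ha & Hb & ->).
    destruct (IH _ Ha) as (c & s & Hs & -> & H).
    exists (WL c b), s. repeat split; auto.
    intros y' t Ht. apply sem_comp_mul; auto.
  - apply sem_comp_inv in Hz. destruct Hz as (a & b & Ha & Hb & ->).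
    destruct (IH _ Hb) as (c & s & Hs & -> & H).
    exists (WR a c), s. repeat split; auto.
    intros y' t Ht. apply sem_comp_mul; auto.
Qed.

(** * Soundness of the calculus *)

Definition valid (x : st) (d : stoup) : Prop :=
  forall z, sem_st x z -> sem_stoup d z.

Lemma valid_fill u x y d :
  (forall z, sem_st x z -> cl (sem_st y) z) ->
  valid (fill u y) d -> valid (fill u x) d.
Proof.
  intros H Hy z Hz. destruct (sem_fill _ _ _ Hz) as (c & s & Hs & -> & Hc).
  apply (closed_mfill (sem_st y)); auto using closed_sem_stoup.
Qed.

(** Since [one] is idempotent, the closures at the leaves multiply to the closure of a subset of
    [{one}]. Recording [sem_st k one] allows [one] to be expanded into [k] again at another
    place. *)
Lemma sem_k k z : is_k k -> sem_st k z ->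
  cl (fun x => x = one /\ sem_st k one) z.
Proof.
  destruct k as [t|]; simpl; [|intros _ ->; apply cl_incl; auto].
  revert z. induction t as [a|s IHs t IHt]; simpl; intros z Hk Hz.
  - destruct a; try contradiction. apply (cl_bind _ _ _ Hz).
    intros x [-> H]. apply cl_incl. split; auto. apply cl_incl; auto.
  - destruct Hk as [Hs Ht]. destruct Hz as (a & b & Ha & Hb & ->).
    apply (cl_mul _ _ _ _ _ (IHs _ Hs Ha) (IHt _ Ht Hb)).
    intros x y [-> Hx] [-> Hy]. rewrite one_mul. apply cl_incl.
    split; auto. exists one, one; auto.
Qed.

Lemma sem_k_mfill k z c (S : W -> Prop) : is_k k -> sem_st k z ->
  (sem_st k one -> S (mfill c one)) -> cl S (mfill c z).
Proof.
  intros Hk Hz H. apply (cl_mfill _ _ c z (sem_k k z Hk Hz)).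
  intros s [-> Hs]. apply cl_incl; auto.
Qed.

(** Most left rules reduce by [valid_fill] to an inclusion between the meanings of the replaced
    parts. In a rule for [k], the element of [k] is collapsed to [one], which can then be inserted
    wherever the premise has [k]. *)
Theorem prov_valid R x d : prov R x d -> valid x d.
Proof.
  induction 1; unfold valid in *; cbn [sem_stoup sem] in *.
  - auto.
  - intros z ->. apply cl_incl; auto.
  - auto.
  - revert IHprov2. apply (valid_fill u x (F a) d). intros z Hz.
    apply cl_incl. simpl. auto.
  - revert IHprov. apply (valid_fill u (F One) eps d). auto.
  - auto.
  - revert IHprov2. apply (valid_fill u _ (F b) d). intros z Hz.
    apply cl_incl. apply sem_comp_inv in Hz.
    destruct Hz as (y & s & Hy & Hs & ->). exact (Hs y (IHprov1 y Hy)).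
  - intros z Hz y Hy. apply IHprov. apply sem_comp_mul; auto.
  - revert IHprov2. apply (valid_fill u _ (F b) d). intros z Hz.
    apply cl_incl. apply sem_comp_inv in Hz.
    destruct Hz as (y & s & Hy & Hs & ->). exact (Hy s (IHprov1 s Hs)).
  - intros z Hz y Hy. apply IHprov. apply sem_comp_mul; auto.
  - revert IHprov. apply valid_fill. auto.
  - intros z Hz. apply sem_comp_inv in Hz.
    destruct Hz as (s & t & Hs & Ht & ->). apply cl_incl.
    exists s, t; auto.
  - revert IHprov. apply valid_fill. intros z [Hz _]. apply cl_incl; auto.
  - revert IHprov. apply valid_fill. intros z [_ Hz]. apply cl_incl; auto.
  - auto.
  - intros z Hz. destruct (sem_fill _ _ _ Hz) as (c & s & Hs & -> & Hc).
    apply (closed_mfill _ _ c s (closed_sem_stoup d) Hs).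
    intros t [Ht|Ht]; [apply IHprov1|apply IHprov2]; apply Hc; auto.
  - intros z Hz. apply cl_incl; auto.
  - intros z Hz. apply cl_incl; auto.
  - revert IHprov. apply valid_fill. intros z Hz.
    apply (cl_bind _ _ _ Hz). intros x [-> Hx]. apply cl_incl; auto.
  - intros z Hz. apply (cl_bind _ _ _ (sem_k _ _ H Hz)).
    intros x [-> Hx]. apply cl_incl. auto.
  - revert IHprov. apply valid_fill. intros z Hz.
    apply (cl_bind _ _ _ (sem_k _ _ H Hz)).
    intros x [-> Hx]. apply cl_incl. reflexivity.
  - revert IHprov. apply valid_fill. intros z Hz.
    apply (cl_bind _ _ _ (sem_k _ _ H Hz)).
    intros x [-> Hx]. apply cl_incl. rewrite <- (one_mul one).
    apply sem_comp_mul; auto.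
  - revert IHprov. apply valid_fill. intros z Hz.
    apply sem_comp_inv in Hz. destruct Hz as (a & b & Ha & Hb & ->).
    apply (sem_k_mfill k b (WR a WHole)); auto. simpl. intros H1.
    rewrite mul_one, <- (one_mul a). apply sem_comp_mul; auto.
  - revert IHprov. apply valid_fill. intros z Hz.
    apply sem_comp_inv in Hz. destruct Hz as (a & b & Ha & Hb & ->).
    apply (sem_k_mfill k a (WL WHole b)); auto. simpl. intros H1.
    rewrite one_mul, <- (mul_one b). apply sem_comp_mul; auto.
  - revert IHprov. apply valid_fill. intros z' Hz.
    apply sem_comp_inv in Hz. destruct Hz as (a & b & Ha & Hb & ->).
    apply (sem_k_mfill k a (WL WHole b)); auto. simpl. intros H1.
    apply sem_comp_inv in Hb. destruct Hb as (b1 & b2 & Hb1 & Hb2 & ->).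
    rewrite one_mul, <- (one_mul b1).
    apply sem_comp_mul; auto. apply sem_comp_mul; auto.
  - revert IHprov. apply valid_fill. intros z' Hz.
    apply sem_comp_inv in Hz. destruct Hz as (a & b & Ha & Hb & ->).
    apply sem_comp_inv in Ha. destruct Ha as (a1 & a2 & Ha1 & Ha2 & ->).
    apply (sem_k_mfill k a1 (WL (WL WHole a2) b)); auto. simpl. intros H1.
    rewrite one_mul, <- (one_mul (mul a2 b)).
    apply sem_comp_mul; auto. apply sem_comp_mul; auto.
  - revert IHprov. apply valid_fill. intros z' Hz.
    apply sem_comp_inv in Hz. destruct Hz as (a & b & Ha & Hb & ->).
    apply sem_comp_inv in Hb. destruct Hb as (b1 & b2 & Hb1 & Hb2 & ->).
    apply (sem_k_mfill k b2 (WR a (WR b1 WHole))); auto. simpl. intros H1.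
    rewrite mul_one, <- (mul_one (mul a b1)).
    apply sem_comp_mul; auto. apply sem_comp_mul; auto.
  - revert IHprov. apply valid_fill. intros z' Hz.
    apply sem_comp_inv in Hz. destruct Hz as (a & b & Ha & Hb & ->).
    apply (sem_k_mfill k b (WR a WHole)); auto. simpl. intros H1.
    apply sem_comp_inv in Ha. destruct Ha as (a1 & a2 & Ha1 & Ha2 & ->).
    rewrite mul_one, <- (mul_one a2).
    apply sem_comp_mul; auto. apply sem_comp_mul; auto.
  - revert IHprov. apply valid_fill. intros z Hz.
    apply sem_comp_inv in Hz. destruct Hz as (a & b & Ha & Hb & ->).
    intros c Hc. apply Acc_exchange. apply Hc. apply sem_comp_mul; auto.
  - revert IHprov. apply valid_fill. intros z Hz.
    intros c Hc. apply Acc_contraction. apply Hc. apply sem_comp_mul; auto.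
  - intros z Hz. apply (closed_sem a). apply (cl_bind _ _ _ (IHprov z Hz)). contradiction.
Qed.

End ClosureSemantics.

(** * Derivations from a theory *)

Fixpoint ctx_comp (w u : ctx) : ctx :=
  match w with
  | Hole => u
  | CL w y => CL (ctx_comp w u) y
  | CR y w => CR y (ctx_comp w u)
  end.

Lemma fill_ctx_comp w u x : fill (ctx_comp w u) x = fill w (fill u x).
Proof. induction w; simpl; congruence. Qed.

Fixpoint big_and (l : list fm) : fm :=
  match l with [] => One | a :: l => And a (big_and l) end.

Definition mul_list (q : fm) (l : list fm) : fm := fold_left Mul l q.
Definition comp_list (q : st) (l : list st) : st := fold_left comp l q.

Section Derivations.

Variable R : srule -> Prop.

(** Read upwards, [k] descends along the path to the hole: by (ka1) where the path turns left, by
    (ke), (ka2) and (ke) again where it turns right. *)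
Lemma prov_k_inward w u k x d : is_k k ->
  prov R (fill w (fill u (comp k x))) d -> prov R (fill w (comp k (fill u x))) d.
Proof.
  intros Hk. revert w.
  induction u as [|u IH y|y u IH]; simpl; intros w H; auto.
  - apply r_ka1a; auto.
    specialize (IH (ctx_comp w (CL Hole y))). rewrite !fill_ctx_comp in IH.
    apply IH, H.
  - apply r_ke2, r_ka2b; auto.
    specialize (IH (ctx_comp w (CR y Hole))). rewrite !fill_ctx_comp in IH.
    assert (H' := r_ke1 R (ctx_comp w (CR y Hole)) k (fill u x) d Hk).
    rewrite !fill_ctx_comp in H'. apply H', IH, H.
Qed.

Lemma prov_big_and u l a d : In a l ->
  prov R (fill u (F a)) d -> prov R (fill u (F (big_and l))) d.
Proof.
  induction l as [|b l IH]; simpl; [contradiction|].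
  intros [->|Ha] H; [apply r_andL1|apply r_andL2]; auto.
Qed.

Lemma prov_mul_list q qs l : prov R q (Some qs) ->
  prov R (comp_list q (map F l)) (Some (mul_list qs l)).
Proof.
  revert q qs. induction l as [|a l IH]; simpl; intros q qs H; auto.
  apply IH. apply r_mulR; auto. apply ax_id.
Qed.

(** * A theory as a rewriting system *)

Variable Theta : list fm.
Variable goal : fm.

Definition derives (x : st) : Prop :=
  prov R (comp (F (Bang (big_and Theta))) x) (Some goal).

(** Rewriting follows a derivation from its conclusion to its premises, hence the implication runs
    from [y] to [x]. *)
Definition rew (x y : st) : Prop :=
  forall u, derives (fill u y) -> derives (fill u x).

Definition rew2 (x y z : st) : Prop :=
  forall u, derives (fill u y) -> derives (fill u z) -> derives (fill u x).

Lemma derives_goal : derives (F goal).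
Proof.
  unfold derives. apply (r_kw R (CL Hole (F goal)) (F (Bang (big_and Theta)))).
  - exact I.
  - apply ax_id.
Qed.

(** (kc) doubles the theory. One copy stays in front; the other is carried to the right of [x],
    opened to the conjunct [LDiv a b] and consumed by the left rule for the division. *)
Lemma rew_axiom x a b : In (LDiv a b) Theta -> prov R x (Some a) -> rew x (F b).
Proof.
  intros Hin Hx u H. unfold derives in *.
  set (k := F (Bang (big_and Theta))) in *.
  assert (Hk : is_k k) by exact I.
  apply (r_kc R (CL Hole (fill u x)) k _ Hk).
  apply (r_ka1b R Hole k k (fill u x) _ Hk).
  apply (prov_k_inward (CR k Hole) u k x _ Hk).
  change (fill (CR k Hole) (fill u (comp k x)))
    with (fill (CR k u) (comp k x)).
  apply r_ke2; auto.
  change (fill (CR k u) (comp x k)) with (fill (CR k u) (fill (CR x Hole) k)).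
  rewrite <- fill_ctx_comp. apply r_bangL, (prov_big_and _ _ _ _ Hin).
  rewrite fill_ctx_comp. apply (r_ldivL R (CR k u) x a b); auto.
Qed.

Lemma rew_refl x : rew x x.
Proof. intros u. auto. Qed.

Lemma rew_trans y x z : rew x y -> rew y z -> rew x z.
Proof. intros Hx Hy u H. auto. Qed.

Lemma rew_fill u x y : rew x y -> rew (fill u x) (fill u y).
Proof.
  intros H w. rewrite <- !fill_ctx_comp. apply H.
Qed.

Lemma rew_comp x x' y y' : rew x x' -> rew y y' -> rew (comp x y) (comp x' y').
Proof.
  intros Hx Hy. apply (rew_trans (comp x' y)).
  - apply (rew_fill (CL Hole y)), Hx.
  - apply (rew_fill (CR x' Hole)), Hy.
Qed.

Lemma rew_mul a b : rew (F (Mul a b)) (comp (F a) (F b)).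
Proof.
  intros u. apply (r_mulL R (CR (F (Bang (big_and Theta))) u)).
Qed.

Lemma rew2_or a b : rew2 (F (Or a b)) (F a) (F b).
Proof.
  intros u. apply (r_orL R (CR (F (Bang (big_and Theta))) u)).
Qed.

Lemma rew2_axiom x a b c : In (LDiv a (Or b c)) Theta -> prov R x (Some a) ->
  rew2 x (F b) (F c).
Proof.
  intros Hin Hx u Hb Hc. apply (rew_axiom x a _ Hin Hx), rew2_or; auto.
Qed.

Lemma rew2_fill u x y z : rew2 x y z -> rew2 (fill u x) (fill u y) (fill u z).
Proof.
  intros H w. rewrite <- !fill_ctx_comp. apply H.
Qed.

Lemma rew2_trans x y z y' z' : rew2 x y z -> rew y y' -> rew z z' -> rew2 x y' z'.
Proof. intros H Hy Hz u Hu Hu'. apply H; [apply Hy|apply Hz]; auto. Qed.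

Lemma rew_comp_list {I : Type} q q' (f f' : I -> st) l :
  rew q q' -> (forall i, In i l -> rew (f i) (f' i)) ->
  rew (comp_list q (map f l)) (comp_list q' (map f' l)).
Proof.
  revert q q'. induction l as [|i l IH]; simpl; intros q q' Hq H; auto.
  apply IH; auto. apply rew_comp; auto.
Qed.

Lemma rew_mul_list qs l : rew (F (mul_list qs l)) (comp_list (F qs) (map F l)).
Proof.
  induction l as [|a l IH] using rev_ind; [apply rew_refl|].
  unfold mul_list, comp_list in *. rewrite map_app, !fold_left_app.
  apply (rew_trans _ _ _ (rew_mul _ _)). apply rew_comp; auto using rew_refl.
Qed.

Lemma comp_list_ctx_head l : exists u, forall q, comp_list q l = fill u q.
Proof.
  induction l as [|a l [u IH]] using rev_ind; [exists Hole; auto|].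
  exists (CL u a). intros q. unfold comp_list in *.
  rewrite fold_left_app. simpl. congruence.
Qed.

Lemma comp_list_ctx q l l' :
  exists u, forall x, comp_list q (l ++ x :: l') = fill u x.
Proof.
  destruct (comp_list_ctx_head l') as [u Hu].
  exists (ctx_comp u (CR (comp_list q l) Hole)). intros x.
  rewrite fill_ctx_comp, <- Hu. unfold comp_list. rewrite fold_left_app. reflexivity.
Qed.

End Derivations.

(** * The theory of a counter machine *)

Inductive kind : Type := KInc | KDec | KZero.

Record trans : Type := Trans { src : nat; reg : nat; op : kind; tgt : nat }.

Definition fire (k : kind) (n : nat) : option nat :=
  match k, n with
  | KInc, _ => Some (S n)
  | KDec, S n => Some n
  | KZero, 0 => Some 0
  | _, _ => None
  end.

(** Some run of a nondeterministic machine reaches [h]; zero tests are transitions of their own. A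
    transition is named by its position [t], which the atoms carry as parameter. *)
Inductive accepting (trs : list trans) (h : nat) : nat -> (nat -> nat) -> Prop :=
| accepting_halt g : accepting trs h h g
| accepting_step t tr g n :
    nth_error trs t = Some tr -> fire (op tr) (g (reg tr)) = Some n ->
    accepting trs h (tgt tr) (upd g (reg tr) n) -> accepting trs h (src tr) g.

(** [AReq] and [ADoneTest] are control leaves; the idle, done, request-test and reset-test atoms are
    innermost leaves of registers. [Sig] marks a copy that eats the tokens around it, so that a
    register of any content shrinks to one atom; [Test] marks the leaf of a checking branch. *)
Inductive atom : Type :=
| AGoal
| AStart
| ATok (i : nat)
| AIdle (i : nat)
| AIdleSig (i : nat)
| ADone (t : nat)
| ADoneSig (t : nat)
| AReqTest (t : nat)
| AResetTest (t : nat)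
| AReq (p : nat)
| ADoneTest (t : nat).

(** Two constants, then nine parametrised families, one for each residue class modulo 9. *)
Definition atom_index (a : atom) : nat :=
  match a with
  | AGoal => 0
  | AStart => 1
  | ATok i => 2 + 9 * i
  | AIdle i => 3 + 9 * i
  | AIdleSig i => 4 + 9 * i
  | ADone t => 5 + 9 * t
  | ADoneSig t => 6 + 9 * t
  | AReqTest t => 7 + 9 * t
  | AResetTest t => 8 + 9 * t
  | AReq p => 9 + 9 * p
  | ADoneTest t => 10 + 9 * t
  end.

Lemma atom_index_inj a b : atom_index a = atom_index b -> a = b.
Proof.
  destruct a, b; cbn [atom_index]; intros H;
    first [reflexivity | exfalso; lia | f_equal; lia].
Qed.

Definition V (a : atom) : fm := Var (atom_index a).

Definition sig_except (i : nat) (a : atom) (j : nat) : atom :=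
  if j =? i then a else AIdleSig j.

Section Theory.

Variable trs : list trans.
Variables m start halt : nat.
Hypothesis reg_le : forall t tr, nth_error trs t = Some tr -> reg tr <= m.

(* Register 0 comes last, so that it is the right subtree of the root and the
   rest of the initial configuration can be unfolded from the single atom [AStart]. *)
Definition registers : list nat := seq 1 m ++ [0].

Lemma in_registers i : In i registers <-> i <= m.
Proof. unfold registers. rewrite in_app_iff, in_seq. simpl. lia. Qed.

Lemma NoDup_registers : NoDup registers.
Proof.
  apply NoDup_app; [apply seq_NoDup|repeat constructor; simpl; tauto|].
  intros a Ha [<-|[]]. apply in_seq in Ha. lia.
Qed.

Definition accept_rule (q : atom) (f : nat -> atom) : fm :=
  LDiv (mul_list (V q) (map (fun i => V (f i)) registers)) (V AGoal).

Definition start_rule : fm :=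
  LDiv (V AStart) (mul_list (V (AReq start)) (map (fun i => V (AIdle i)) (seq 1 m))).

Definition eat_rule (i : nat) (a : atom) : fm :=
  LDiv (Mul (V (ATok i)) (V a)) (V a).

Definition register_rules (i : nat) : list fm :=
  [LDiv (V (AIdle i)) (V (AIdleSig i)); eat_rule i (AIdleSig i)].

(* A step is a handshake: the register moves, then the control, then the register
   is reset. The second disjunct of each move destroys the moving component, so
   that the remaining derivation can only check the state of the other ones. *)
Definition trans_rules (t : nat) (tr : trans) : list fm :=
  let i := reg tr in
  [match op tr with
   | KInc => LDiv (V (AIdle i))
       (Or (Mul (V (ATok i)) (V (ADone t))) (V (AReqTest t)))
   | KDec => LDiv (Mul (V (ATok i)) (V (AIdle i)))
       (Or (V (ADone t)) (V (AReqTest t)))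
   | KZero => LDiv (V (AIdle i)) (Or (V (ADone t)) (V (AReqTest t)))
   end;
   LDiv (V (AReq (src tr))) (Or (V (AReq (tgt tr))) (V (ADoneTest t)));
   LDiv (V (ADone t)) (Or (V (AIdle i)) (V (AResetTest t)));
   LDiv (V (ADone t)) (V (ADoneSig t));
   eat_rule i (ADoneSig t);
   eat_rule i (AResetTest t);
   (* After a zero test, [AReqTest] has to survive without eating any token. *)
   match op tr with KZero => One | _ => eat_rule i (AReqTest t) end;
   accept_rule (AReq (src tr)) (sig_except i (AReqTest t));
   accept_rule (AReq (tgt tr)) (sig_except i (AResetTest t));
   accept_rule (ADoneTest t) (sig_except i (ADoneSig t))].

Definition theory : list fm :=
  start_rule :: accept_rule (AReq halt) AIdleSig ::
  flat_map register_rules (seq 0 (S m)) ++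
  flat_map (fun t => match nth_error trs t with
                     | Some tr => trans_rules t tr
                     | None => []
                     end) (seq 0 (length trs)).

Lemma in_theory a : In a theory <->
  a = start_rule \/ a = accept_rule (AReq halt) AIdleSig \/
  (exists i, i <= m /\ In a (register_rules i)) \/
  (exists t tr, nth_error trs t = Some tr /\ In a (trans_rules t tr)).
Proof.
  unfold theory. cbn [In]. rewrite in_app_iff, !in_flat_map. split.
  - intros [<-|[<-|[(i & Hi & Ha)|(t & Ht & Ha)]]]; auto.
    + right; right; left. exists i. split; auto. apply in_seq in Hi. lia.
    + destruct (nth_error trs t) as [tr|] eqn:E; [|destruct Ha].
      right; right; right. eauto.
  - intros [->|[->|[(i & Hi & Ha)|(t & tr & Ht & Ha)]]]; auto.
    + right; right; left. exists i. split; auto. apply in_seq. lia.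
    + right; right; right. exists t. rewrite Ht. split; auto.
      apply in_seq. assert (t < length trs) by (apply nth_error_Some; congruence). lia.
Qed.

(** * Configurations as trees *)

Definition comb (i n : nat) (x : st) : st := Nat.iter n (comp (F (V (ATok i)))) x.

Definition config_tree (p : nat) (g : nat -> nat) : st :=
  comp_list (F (V (AReq p))) (map (fun i => comb i (g i) (F (V (AIdle i)))) registers).

Definition replace {A : Type} (f : nat -> A) (i : nat) (x : A) (j : nat) : A :=
  if j =? i then x else f j.

Lemma replace_same {A : Type} (f : nat -> A) i : replace f i (f i) = f.
Proof.
  apply functional_extensionality. intros j. unfold replace.
  destruct (Nat.eqb_spec j i); congruence.
Qed.

(** Registers are listed without repetition, so replacing the [i]-th structure affects a single
    position and the rest is a context independent of [x]. *)
Lemma comp_list_replace q (f : nat -> st) i : i <= m ->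
  exists u, forall x, comp_list q (map (replace f i x) registers) = fill u x.
Proof.
  intros Hi. apply in_registers in Hi.
  destruct (in_split _ _ Hi) as (l1 & l2 & E).
  assert (HN := NoDup_registers). rewrite E in HN. apply NoDup_remove_2 in HN.
  destruct (comp_list_ctx q (map f l1) (map f l2)) as [u Hu].
  exists u. intros x. rewrite <- Hu, E, map_app. simpl. f_equal. f_equal; [|f_equal].
  - apply map_ext_in. intros j Hj. unfold replace.
    destruct (Nat.eqb_spec j i) as [->|]; auto.
    destruct HN. apply in_app_iff; auto.
  - unfold replace. rewrite Nat.eqb_refl. reflexivity.
  - apply map_ext_in. intros j Hj. unfold replace.
    destruct (Nat.eqb_spec j i) as [->|]; auto.
    destruct HN. apply in_app_iff; auto.
Qed.

(** * Accepting runs yield derivations *)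

Section Completeness.

Variable R : srule -> Prop.

Notation derives := (derives R theory (V AGoal)).
Notation rew := (rew R theory (V AGoal)).
Notation rew2 := (rew2 R theory (V AGoal)).

Lemma comb_ctx i n : exists u, forall x, comb i n x = fill u x.
Proof.
  induction n as [|n [u IH]]; [exists Hole; auto|].
  exists (CR (F (V (ATok i))) u). intros x. simpl. rewrite <- IH. reflexivity.
Qed.

Lemma comb_comp i n x : comb i n (comp (F (V (ATok i))) x) = comb i (S n) x.
Proof. symmetry. apply Nat.iter_succ_r. Qed.

Lemma rew_comb i n x y : rew x y -> rew (comb i n x) (comb i n y).
Proof. destruct (comb_ctx i n) as [u Hu]. rewrite !Hu. apply rew_fill. Qed.

Lemma rew2_comb i n x y z : rew2 x y z -> rew2 (comb i n x) (comb i n y) (comb i n z).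
Proof. destruct (comb_ctx i n) as [u Hu]. rewrite !Hu. apply rew2_fill. Qed.

Lemma prov_mul_id a b : prov R (comp (F a) (F b)) (Some (Mul a b)).
Proof. apply r_mulR; apply ax_id. Qed.

Lemma rew_comb_eat i n a : In (eat_rule i a) theory ->
  rew (comb i n (F (V a))) (F (V a)).
Proof.
  intros H. induction n as [|n IH]; [apply rew_refl|].
  change (comb i (S n) (F (V a))) with (comp (F (V (ATok i))) (comb i n (F (V a)))).
  apply (rew_trans _ _ _ (comp (F (V (ATok i))) (F (V a)))).
  - apply rew_comp; auto using rew_refl.
  - apply (rew_axiom _ _ _ _ _ _ H), prov_mul_id.
Qed.

Lemma rew_comb_idle i n : i <= m ->
  rew (comb i n (F (V (AIdle i)))) (F (V (AIdleSig i))).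
Proof.
  intros Hi. assert (Hin : forall a, In a (register_rules i) -> In a theory).
  { intros a Ha. apply in_theory. right; right; left. eauto. }
  apply (rew_trans _ _ _ (comb i n (F (V (AIdleSig i))))).
  - apply rew_comb. apply (rew_axiom _ _ _ _ (V (AIdle i))); [|apply ax_id].
    apply Hin. simpl. auto.
  - apply rew_comb_eat, Hin. simpl. auto.
Qed.

Lemma derives_accept q (x : nat -> st) f : In (accept_rule q f) theory ->
  (forall i, i <= m -> rew (x i) (F (V (f i)))) ->
  derives (comp_list (F (V q)) (map x registers)).
Proof.
  intros Hin H.
  assert (H1 : rew (comp_list (F (V q)) (map x registers)) (F (V AGoal))).
  { apply (rew_trans _ _ _ (comp_list (F (V q)) (map (fun i => F (V (f i))) registers))).
    - apply rew_comp_list; [apply rew_refl|].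
      intros i Hi. apply H, in_registers, Hi.
    - apply (rew_axiom _ _ _ _ _ _ Hin).
      replace (map (fun i => F (V (f i))) registers)
        with (map F (map (fun i => V (f i)) registers)) by apply map_map.
      apply prov_mul_list, ax_id. }
  apply (H1 Hole). apply derives_goal.
Qed.

(** All registers but [i] shrink to their idle signals, so a checking branch only compares the
    control with the state of register [i]. *)
Lemma derives_test q g i x a : In (accept_rule q (sig_except i a)) theory ->
  rew x (F (V a)) ->
  derives (comp_list (F (V q))
    (map (replace (fun j => comb j (g j) (F (V (AIdle j)))) i x) registers)).
Proof.
  intros Hin Hx. apply (derives_accept _ _ _ Hin). intros j Hj.
  unfold replace, sig_except. destruct (j =? i); auto. apply rew_comb_idle, Hj.
Qed.

Lemma derives_branch_register q f i x y z : i <= m -> rew2 x y z ->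
  derives (comp_list q (map (replace f i y) registers)) ->
  derives (comp_list q (map (replace f i z) registers)) ->
  derives (comp_list q (map (replace f i x) registers)).
Proof.
  intros Hi H. destruct (comp_list_replace q f i Hi) as [u Hu].
  rewrite !Hu. apply H.
Qed.

Lemma derives_branch_control q q' q'' l : rew2 q q' q'' ->
  derives (comp_list q' l) -> derives (comp_list q'' l) -> derives (comp_list q l).
Proof.
  intros H. destruct (comp_list_ctx_head l) as [u Hu]. rewrite !Hu. apply H.
Qed.

(** The checking branch [x] is existential because its tokens vary: after an increment or a
    decrement [AReqTest] eats them, after a zero test there are none. *)
Lemma rew2_register_move t tr n n' : nth_error trs t = Some tr ->
  fire (op tr) n = Some n' ->
  exists x, rew x (F (V (AReqTest t))) /\
    rew2 (comb (reg tr) n (F (V (AIdle (reg tr))))) (comb (reg tr) n' (F (V (ADone t)))) x.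
Proof.
  intros Ht Hn.
  assert (Hin : forall a, In a (trans_rules t tr) -> In a theory).
  { intros a Ha. apply in_theory. right; right; right. eauto. }
  unfold trans_rules in Hin. destruct (op tr); [|destruct n|destruct n];
    simpl in Hn; try discriminate; injection Hn as <-.
  - exists (comb (reg tr) n (F (V (AReqTest t)))). split.
    + apply rew_comb_eat, Hin. simpl. tauto.
    + rewrite <- comb_comp. apply rew2_comb.
      eapply rew2_trans; [|apply rew_mul|apply rew_refl].
      eapply rew2_axiom; [apply Hin; left; reflexivity|apply ax_id].
  - exists (comb (reg tr) n (F (V (AReqTest t)))). split.
    + apply rew_comb_eat, Hin. simpl. tauto.
    + rewrite <- comb_comp. apply rew2_comb.
      eapply rew2_axiom; [apply Hin; left; reflexivity|apply prov_mul_id].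
  - exists (F (V (AReqTest t))). split; [apply rew_refl|].
    eapply rew2_axiom; [apply Hin; left; reflexivity|apply ax_id].
Qed.

Theorem accepting_derives p g : accepting trs halt p g -> derives (config_tree p g).
Proof.
  induction 1 as [g|t tr g n Ht Hn _ IH].
  - apply derives_accept with (f := AIdleSig).
    + apply in_theory. auto.
    + intros i Hi. apply rew_comb_idle, Hi.
  - assert (Hin : forall a, In a (trans_rules t tr) -> In a theory).
    { intros a Ha. apply in_theory. right; right; right. eauto. }
    assert (Hi := reg_le _ _ Ht).
    destruct (rew2_register_move _ _ _ _ Ht Hn) as (x & Hx & Hmove).
    unfold config_tree. set (f := fun i => comb i (g i) (F (V (AIdle i)))).
    rewrite <- (replace_same f (reg tr)).
    (* First move: the register changes. The side branch checks that the control is still at the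
       source. *)
    apply (derives_branch_register _ _ _ _ _ _ Hi Hmove).
    2:{ apply derives_test with (a := AReqTest t); auto.
        apply Hin. unfold trans_rules. simpl. tauto. }
    (* Second move: the control advances to the target. The side branch checks that the register is
       done. *)
    apply derives_branch_control with (q' := F (V (AReq (tgt tr))))
      (q'' := F (V (ADoneTest t))).
    { eapply rew2_axiom; [|apply ax_id]. apply Hin. unfold trans_rules. simpl. tauto. }
    2:{ apply derives_test with (a := ADoneSig t).
        - apply Hin. unfold trans_rules. simpl. tauto.
        - apply (rew_trans _ _ _ (comb (reg tr) n (F (V (ADoneSig t))))).
          + apply rew_comb. eapply rew_axiom; [|apply ax_id].
            apply Hin. unfold trans_rules. simpl. tauto.
          + apply rew_comb_eat, Hin. unfold trans_rules. simpl. tauto. }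
    (* Third move: the register becomes idle again. The side branch checks that the control has
       reached the target. *)
    apply (derives_branch_register _ _ _ _
      (comb (reg tr) n (F (V (AIdle (reg tr)))))
      (comb (reg tr) n (F (V (AResetTest t)))) Hi).
    { apply rew2_comb. eapply rew2_axiom; [|apply ax_id].
      apply Hin. unfold trans_rules. simpl. tauto. }
    + replace (replace f (reg tr) (comb (reg tr) n (F (V (AIdle (reg tr))))))
        with (fun i => comb i (upd g (reg tr) n i) (F (V (AIdle i)))); [exact IH|].
      apply functional_extensionality. intros j. unfold replace, upd.
      destruct (Nat.eqb_spec j (reg tr)) as [->|]; reflexivity.
    + apply derives_test with (a := AResetTest t).
      * apply Hin. unfold trans_rules. simpl. tauto.
      * apply rew_comb_eat, Hin. unfold trans_rules. simpl. tauto.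
Qed.

(** Only [AStart] and register 0 occur, so the tree depends on the input alone; the machine enters
    through the theory. *)
Definition initial_tree (n : nat) : st :=
  comp (F (V AStart)) (comb 0 n (F (V (AIdle 0)))).

Theorem accepting_derives_initial n :
  accepting trs halt start (snd (init n)) -> derives (initial_tree n).
Proof.
  intros H. apply accepting_derives in H.
  unfold config_tree, registers, comp_list in H.
  rewrite map_app, fold_left_app in H. simpl in H. revert H.
  apply (rew_fill _ _ _ (CL Hole _) (F (V AStart))) with (u := Hole).
  apply (rew_trans _ _ _ (F (mul_list (V (AReq start)) (map (fun i => V (AIdle i)) (seq 1 m))))).
  - apply (rew_axiom _ _ _ _ (V AStart)); [left; reflexivity|apply ax_id].
  - eapply rew_trans; [apply rew_mul_list|]. rewrite map_map. unfold comp_list.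
    erewrite map_ext_in; [apply rew_refl|].
    intros i Hi. simpl. apply in_seq in Hi. destruct i; [lia|reflexivity].
Qed.

End Completeness.
End Theory.

(** * The model *)

Inductive state : Type :=
| Idle
| Done (t : nat)
| ReqTest (t : nat)
| ResetTest (t : nat)
| Req (p : nat)
| DoneTest (t : nat).

(* Position 0 carries the control, position [S i] the register [i]. *)
Definition cell : Type := (nat * (state * nat))%type.

Inductive world : Type :=
| Token (i : nat)
| Cells (l : list cell)
| Junk.

Definition unit_world : world := Cells [].

Definition absorb (i : nat) (l : list cell) : world :=
  match l with
  | [(j, (s, n))] => if S i =? j then Cells [(j, (s, S n))] else Junk
  | _ => Junk
  end.

(* Commutative up to the order of cells, but associative only away from tokens:
   a token is absorbed by a single cell but not by an assembled configuration. *)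
Definition wmul (x y : world) : world :=
  match x, y with
  | Cells [], _ => y
  | _, Cells [] => x
  | Cells l, Cells l' => Cells (l ++ l')
  | Token i, Cells l | Cells l, Token i => absorb i l
  | _, _ => Junk
  end.

(** The default turns a register without a cell into an idle register of value 0, which agrees with
    the initial configuration beyond the last register. *)
Definition get (l : list cell) (j : nat) : state * nat :=
  match find (fun c => fst c =? j) l with Some c => snd c | None => (Idle, 0) end.

Lemma unit_wmul x : wmul unit_world x = x.
Proof. reflexivity. Qed.

Lemma wmul_unit x : wmul x unit_world = x.
Proof. destruct x as [i|[|c l]|]; reflexivity. Qed.

Lemma wmul_cells l l' : wmul (Cells l) (Cells l') = Cells (l ++ l').
Proof.
  destruct l as [|c l]; [reflexivity|]. destruct l' as [|c' l'].
  - rewrite app_nil_r. reflexivity.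
  - reflexivity.
Qed.

Lemma wmul_junk_l x : wmul Junk x = Junk.
Proof. destruct x as [i|[|c l]|]; reflexivity. Qed.

Lemma wmul_junk_r x : wmul x Junk = Junk.
Proof. destruct x as [i|[|c l]|]; reflexivity. Qed.

Lemma absorb_long i l : 2 <= length l -> absorb i l = Junk.
Proof. destruct l as [|[j [s n]] [|c' l]]; simpl; intros; try lia; reflexivity. Qed.

Lemma wmul_cells_token l i : l <> [] -> wmul (Cells l) (Token i) = absorb i l.
Proof. destruct l; [congruence|reflexivity]. Qed.

Lemma wmul_token_cells l i : l <> [] -> wmul (Token i) (Cells l) = absorb i l.
Proof. destruct l; [congruence|reflexivity]. Qed.

Lemma wmul_token_cell i s n : wmul (Token i) (Cells [(S i, (s, n))]) = Cells [(S i, (s, S n))].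
Proof. unfold wmul, absorb. rewrite Nat.eqb_refl. reflexivity. Qed.

(** * How contexts act on cells *)

Notation wctx := (mctx world).
Notation wfill := (mfill world wmul).

(** Two or more cells can no longer absorb a token, so a context either spoils them or merely adds
    cells on both sides. *)
Lemma wfill_long (c : wctx) :
  (forall l, 2 <= length l -> wfill c (Cells l) = Junk) \/
  exists l1 l2, forall l, 2 <= length l -> wfill c (Cells l) = Cells (l1 ++ l ++ l2).
Proof.
  assert (Hlen : forall l1 l l2 : list cell, 2 <= length l -> 2 <= length (l1 ++ l ++ l2)).
  { intros. rewrite !length_app. lia. }
  assert (Hnil : forall l : list cell, 2 <= length l -> l <> []).
  { intros [|] H; simpl in H; [lia|discriminate]. }
  induction c as [|c [IH|(l1 & l2 & IH)] w|w c [IH|(l1 & l2 & IH)]]; simpl.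
  - right. exists [], []. intros l _. rewrite app_nil_r. reflexivity.
  - left. intros l Hl. rewrite IH by auto. apply wmul_junk_l.
  - destruct w as [i|w|].
    + left. intros l Hl. rewrite IH, wmul_cells_token, absorb_long; auto.
    + right. exists l1, (l2 ++ w). intros l Hl. rewrite IH, wmul_cells, <- !app_assoc; auto.
    + left. intros l Hl. apply wmul_junk_r.
  - left. intros l Hl. rewrite IH by auto. apply wmul_junk_r.
  - destruct w as [i|w|].
    + left. intros l Hl. rewrite IH, wmul_token_cells, absorb_long; auto.
    + right. exists (w ++ l1), l2. intros l Hl. rewrite IH, wmul_cells, <- !app_assoc; auto.
    + left. intros l Hl. apply wmul_junk_l.
Qed.

(** A cell absorbs tokens only while it is alone, and whether it does depends on its position, not
    on its state or counter. Hence one number [k] of absorbed tokens fits all states. *)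
Lemma wfill_cell (c : wctx) j :
  (forall s n, wfill c (Cells [(j, (s, n))]) = Junk) \/
  exists k l1 l2, forall s n,
    wfill c (Cells [(j, (s, n))]) = Cells (l1 ++ (j, (s, k + n)) :: l2).
Proof.
  assert (Habs : forall i k l1 l2,
    (forall s n, absorb i (l1 ++ (j, (s, k + n)) :: l2) = Junk) \/
    exists k' l1' l2', forall s n,
      absorb i (l1 ++ (j, (s, k + n)) :: l2) = Cells (l1' ++ (j, (s, k' + n)) :: l2')).
  { intros i k [|x l1] l2; [destruct l2 as [|y l2]|].
    - simpl. destruct j as [|j]; [left; reflexivity|].
      destruct (i =? j); [right|left; reflexivity].
      exists (S k), [], []. reflexivity.
    - left. intros. apply absorb_long. simpl. lia.
    - left. intros. apply absorb_long. simpl. rewrite length_app. simpl. lia. }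
  induction c as [|c [IH|(k & l1 & l2 & IH)] w|w c [IH|(k & l1 & l2 & IH)]]; simpl.
  - right. exists 0, [], []. reflexivity.
  - left. intros s n. rewrite IH. apply wmul_junk_l.
  - destruct w as [i|w|].
    + destruct (Habs i k l1 l2) as [H|(k' & l1' & l2' & H)].
      * left. intros s n. rewrite IH, wmul_cells_token; auto. destruct l1; discriminate.
      * right. exists k', l1', l2'. intros s n.
        rewrite IH, wmul_cells_token; auto. destruct l1; discriminate.
    + right. exists k, l1, (l2 ++ w). intros s n.
      rewrite IH, wmul_cells, <- app_assoc. reflexivity.
    + left. intros. apply wmul_junk_r.
  - left. intros s n. rewrite IH. apply wmul_junk_r.
  - destruct w as [i|w|].
    + destruct (Habs i k l1 l2) as [H|(k' & l1' & l2' & H)].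
      * left. intros s n. rewrite IH, wmul_token_cells; auto. destruct l1; discriminate.
      * right. exists k', l1', l2'. intros s n.
        rewrite IH, wmul_token_cells; auto. destruct l1; discriminate.
    + right. exists k, (w ++ l1), l2. intros s n.
      rewrite IH, wmul_cells, <- app_assoc. reflexivity.
    + left. intros. apply wmul_junk_l.
Qed.

Lemma get_in l j : In j (map fst l) -> In (j, get l j) l.
Proof.
  intros H. unfold get. destruct (find _ l) as [[j' x]|] eqn:E.
  - apply find_some in E. destruct E as [Hin E]. apply Nat.eqb_eq in E.
    simpl in *. subst. exact Hin.
  - apply in_map_iff in H. destruct H as (c & <- & Hc).
    apply find_none with (x := c) in E; auto. rewrite Nat.eqb_refl in E. discriminate.
Qed.

Lemma get_notin l j : ~ In j (map fst l) -> get l j = (Idle, 0).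
Proof.
  intros H. unfold get. destruct (find _ l) as [c|] eqn:E; auto.
  apply find_some in E. destruct E as [Hin E]. apply Nat.eqb_eq in E.
  destruct H. subst. apply in_map, Hin.
Qed.

Lemma get_unique l j x : NoDup (map fst l) -> In (j, x) l -> get l j = x.
Proof.
  induction l as [|[j' y] l IH]; simpl; [contradiction|].
  intros HN H. inversion_clear HN as [|? ? Hnin HN'].
  unfold get. simpl. destruct (Nat.eqb_spec j' j) as [->|Hne].
  - destruct H as [[= ->]|H]; auto. destruct Hnin. apply (in_map fst) in H. exact H.
  - destruct H as [[= -> ->]|H]; [congruence|]. apply IH; auto.
Qed.

Lemma get_perm l l' : NoDup (map fst l) -> Permutation l l' -> get l = get l'.
Proof.
  intros HN HP. apply functional_extensionality. intros j.
  assert (HP' := Permutation_map fst HP).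
  destruct (in_dec Nat.eq_dec j (map fst l)) as [H|H].
  - symmetry. apply get_unique; [apply (Permutation_NoDup HP' HN)|].
    apply (Permutation_in _ HP), get_in, H.
  - rewrite !get_notin; auto.
    intros H'. apply H, (Permutation_in _ (Permutation_sym HP') H').
Qed.

Lemma get_replace l1 l2 j x : NoDup (map fst (l1 ++ (j, x) :: l2)) ->
  get (l1 ++ (j, x) :: l2) = replace (get (l1 ++ l2)) j x.
Proof.
  intros HN.
  rewrite (get_perm _ _ HN (Permutation_sym (Permutation_middle l1 l2 (j, x)))).
  apply functional_extensionality. intros i. unfold replace, get. simpl.
  rewrite (Nat.eqb_sym i). destruct (j =? i); reflexivity.
Qed.

(** * Accepted worlds *)

Section Model.

Variable trs : list trans.
Variables m start halt : nat.
Hypothesis reg_le : forall t tr, nth_error trs t = Some tr -> reg tr <= m.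

Notation accepting := (accepting trs halt).

(** Semantic counterpart of derivability for a control state, an active register [i] with its state
    and content, and the values of all registers. With control [Req p], an idle or done register
    calls for an accepting run, in the case of [Done t] from the target because the counter has
    already changed. Test states only compare control and register. *)
Inductive pass : nat -> state -> state -> nat -> (nat -> nat) -> Prop :=
| pass_idle i p n g : accepting p g -> pass i (Req p) Idle n g
| pass_done t tr p n g : nth_error trs t = Some tr ->
    p = src tr \/ p = tgt tr -> accepting (tgt tr) g ->
    pass (reg tr) (Req p) (Done t) n g
| pass_req_test t tr n g : nth_error trs t = Some tr ->
    (op tr = KZero -> n = 0) -> pass (reg tr) (Req (src tr)) (ReqTest t) n g
| pass_reset_test t tr n g : nth_error trs t = Some tr ->
    pass (reg tr) (Req (tgt tr)) (ResetTest t) n g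
| pass_done_test t tr n g : nth_error trs t = Some tr ->
    pass (reg tr) (DoneTest t) (Done t) n g.

Definition idle_except (i : nat) (g : nat -> state * nat) : Prop :=
  forall j, j <= m -> j <> i -> fst (g (S j)) = Idle.

Definition good (g : nat -> state * nat) : Prop :=
  exists i, i <= m /\ idle_except i g /\
    pass i (fst (g 0)) (fst (g (S i))) (snd (g (S i))) (fun j => snd (g (S j))).

Definition Acc (x : world) : Prop :=
  match x with
  | Cells l => Permutation (map fst l) (seq 0 (S (S m))) /\ good (get l)
  | _ => False
  end.

Lemma Acc_NoDup l : Acc (Cells l) -> NoDup (map fst l).
Proof.
  intros [H _]. apply (Permutation_NoDup (Permutation_sym H)), seq_NoDup.
Qed.

Lemma Acc_perm l l' : Permutation l l' -> Acc (Cells l) -> Acc (Cells l').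
Proof.
  intros HP H. assert (HN := Acc_NoDup _ H). destruct H as [H Hg]. split.
  - rewrite <- H. symmetry. apply Permutation_map, HP.
  - rewrite <- (get_perm _ _ HN HP). exact Hg.
Qed.

(** Order matters only in a product of two nonempty lists of cells. Such a list is long, so the
    context acts by concatenation, and acceptance is invariant under permutation. *)
Lemma Acc_exchange (c : wctx) x y : Acc (wfill c (wmul x y)) -> Acc (wfill c (wmul y x)).
Proof.
  destruct x as [i|[|a l]|], y as [j|[|b l']|]; simpl; auto; cbn [wmul]; auto.
  change (a :: l ++ b :: l') with ((a :: l) ++ (b :: l')).
  change (b :: l' ++ a :: l) with ((b :: l') ++ (a :: l)).
  destruct (wfill_long c) as [H|(l1 & l2 & H)];
    rewrite !H by (rewrite length_app; simpl; lia); auto.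
  apply Acc_perm. apply Permutation_app_head, Permutation_app_tail, Permutation_app_comm.
Qed.

Lemma wfill_junk (c : wctx) : wfill c Junk = Junk.
Proof.
  induction c as [|c IH w|w c IH]; simpl; rewrite ?IH;
    auto using wmul_junk_l, wmul_junk_r.
Qed.

(** A doubled nonempty list repeats a position, which no accepted world does; a doubled token is
    [Junk]. *)
Lemma Acc_contraction (c : wctx) x : Acc (wfill c (wmul x x)) -> Acc (wfill c x).
Proof.
  destruct x as [i|[|a l]|]; simpl; auto.
  - rewrite wfill_junk. contradiction.
  - change (a :: l ++ a :: l) with ((a :: l) ++ (a :: l)).
    destruct (wfill_long c) as [H|(l1 & l2 & H)];
      rewrite H by (rewrite length_app; simpl; lia); [contradiction|].
    intros HA. apply Acc_NoDup in HA.
    rewrite !map_app in HA. apply NoDup_app_remove_l, NoDup_app_remove_r in HA.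
    simpl in HA. inversion HA as [|? ? Hnin _]. destruct Hnin.
    apply in_app_iff. right. left. reflexivity.
Qed.

(** Once some state is accepted in the hole, the positions are right for every state, so acceptance
    depends on [good] alone. A context yielding [Junk] accepts no state, and any [k] and [g]
    serve. *)
Lemma Acc_cell (c : wctx) j : exists k g, forall s0 n0,
  Acc (wfill c (Cells [(j, (s0, n0))])) -> forall s n,
  Acc (wfill c (Cells [(j, (s, n))])) <-> good (replace g j (s, k + n)).
Proof.
  destruct (wfill_cell c j) as [H|(k & l1 & l2 & H)].
  - exists 0, (fun _ => (Idle, 0)). intros s0 n0. rewrite H. contradiction.
  - exists k, (get (l1 ++ l2)). intros s0 n0 H0 s n. rewrite H in *.
    assert (HN := Acc_NoDup _ H0).
    assert (E : map fst (l1 ++ (j, (s, k + n)) :: l2) = map fst (l1 ++ (j, (s0, k + n0)) :: l2)).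
    { rewrite !map_app. reflexivity. }
    simpl. rewrite get_replace by (rewrite E; exact HN). rewrite E.
    destruct H0 as [HP _]. tauto.
Qed.

Definition register_values (g : nat -> state * nat) (i n : nat) : nat -> nat :=
  upd (fun j => snd (g (S j))) i n.

Lemma replaced_values g i s n :
  (fun j => snd (replace g (S i) (s, n) (S j))) = register_values g i n.
Proof.
  apply functional_extensionality. intros j. unfold register_values, upd, replace.
  simpl. destruct (j =? i); reflexivity.
Qed.

Lemma idle_except_replace g i x :
  idle_except i (replace g (S i) x) <-> idle_except i g.
Proof.
  unfold idle_except, replace. simpl. split; intros H j Hj Hne; specialize (H j Hj Hne);
    destruct (Nat.eqb_spec j i); auto; contradiction.
Qed.

(** A register that is not idle must be the witness of [good], since all the others are idle. *)
Lemma good_active g i s n : i <= m -> s <> Idle -> good (replace g (S i) (s, n)) ->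
  idle_except i g /\ pass i (fst (g 0)) s n (register_values g i n).
Proof.
  intros Hi Hs (i' & Hi' & Hidle & Hp).
  assert (i' = i) as ->.
  { destruct (Nat.eq_dec i' i) as [|Hne]; auto. destruct Hs.
    specialize (Hidle i Hi (not_eq_sym Hne)). unfold replace in Hidle.
    rewrite Nat.eqb_refl in Hidle. exact Hidle. }
  rewrite replaced_values in Hp. apply idle_except_replace in Hidle.
  unfold replace in Hp. rewrite Nat.eqb_refl in Hp. auto.
Qed.

Lemma good_replace g i s n : i <= m -> idle_except i g ->
  pass i (fst (g 0)) s n (register_values g i n) -> good (replace g (S i) (s, n)).
Proof.
  intros Hi Hidle Hp. exists i. rewrite replaced_values, idle_except_replace.
  unfold replace. rewrite Nat.eqb_refl. auto.
Qed.

(** Here every register is idle, so whichever one witnesses [good], only [pass_idle] applies. *)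
Lemma good_idle g i n : i <= m -> idle_except i g -> good (replace g (S i) (Idle, n)) ->
  exists p, fst (g 0) = Req p /\ accepting p (register_values g i n).
Proof.
  intros Hi Hidle (i' & Hi' & _ & Hp). rewrite replaced_values in Hp.
  assert (E : fst (replace g (S i) (Idle, n) (S i')) = Idle).
  { unfold replace. simpl. destruct (Nat.eqb_spec i' i); auto. }
  rewrite E in Hp. inversion Hp; subst. eauto.
Qed.

Ltac inv_pass H :=
  inversion H; subst;
  match goal with
  | H1 : nth_error trs ?t = Some ?tr, H2 : nth_error trs ?t = Some ?tr' |- _ =>
      assert (tr' = tr) as -> by congruence; auto
  end.

Lemma pass_req_test_inv i q t tr n g : nth_error trs t = Some tr ->
  pass i q (ReqTest t) n g -> q = Req (src tr) /\ (op tr = KZero -> n = 0).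
Proof. intros Ht H. inv_pass H. Qed.

Lemma pass_reset_test_inv i q t tr n g : nth_error trs t = Some tr ->
  pass i q (ResetTest t) n g -> q = Req (tgt tr).
Proof. intros Ht H. inv_pass H. Qed.

Lemma pass_done_inv i p t tr n g : nth_error trs t = Some tr ->
  pass i (Req p) (Done t) n g -> i = reg tr /\ accepting (tgt tr) g.
Proof. intros Ht H. inv_pass H. Qed.

Lemma pass_done_test_inv i s t tr n g : nth_error trs t = Some tr ->
  pass i (DoneTest t) s n g -> i = reg tr /\ s = Done t.
Proof. intros Ht H. inv_pass H. Qed.

(** * Soundness of the three moves *)

(** The test branch forces the control to be at the source and, for a zero test, the content to be
    0. The done branch then gives an accepting run from the target, which the transition extends. *)
Lemma good_register_move g t tr n n0 n' : nth_error trs t = Some tr ->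
  ((op tr = KZero -> n0 = 0) -> fire (op tr) n = Some n') ->
  good (replace g (S (reg tr)) (Done t, n')) ->
  good (replace g (S (reg tr)) (ReqTest t, n0)) ->
  good (replace g (S (reg tr)) (Idle, n)).
Proof.
  intros Ht Hn HD HT. assert (Hi := reg_le _ _ Ht).
  apply good_active in HT; auto; [|discriminate]. destruct HT as [Hidle HT].
  apply good_active in HD; auto; [|discriminate]. destruct HD as [_ HD].
  apply good_replace; auto.
  destruct (pass_req_test_inv _ _ _ _ _ _ Ht HT) as [E Hz]. rewrite E in *.
  apply (pass_done_inv _ _ _ _ _ _ Ht) in HD. destruct HD as [_ HA].
  apply pass_idle. apply (accepting_step _ _ t tr _ n' Ht).
  - unfold register_values, upd. rewrite Nat.eqb_refl. auto.
  - replace (upd (register_values g (reg tr) n) (reg tr) n')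
      with (register_values g (reg tr) n'); auto.
    apply functional_extensionality. intros j. unfold register_values, upd.
    destruct (j =? reg tr); reflexivity.
Qed.

(** The test branch forces the active register to be [reg tr] in state [Done t]; the other branch
    then gives an accepting run from the target. *)
Lemma good_control_move g t tr n : nth_error trs t = Some tr ->
  good (replace g 0 (Req (tgt tr), n)) -> good (replace g 0 (DoneTest t, n)) ->
  good (replace g 0 (Req (src tr), n)).
Proof.
  intros Ht (i' & Hi' & Hidle' & Hp') (i & Hi & Hidle & Hp).
  unfold replace in *. simpl in *.
  apply (pass_done_test_inv _ _ _ _ _ _ Ht) in Hp. destruct Hp as [-> E].
  assert (i' = reg tr) as ->.
  { destruct (Nat.eq_dec i' (reg tr)) as [|Hne]; auto.
    specialize (Hidle' (reg tr) Hi (not_eq_sym Hne)). simpl in Hidle'. congruence. }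
  exists (reg tr). split; [auto|]. split; [exact Hidle|].
  simpl. rewrite E in *. apply (pass_done_inv _ _ _ _ _ _ Ht) in Hp'.
  apply pass_done; tauto.
Qed.

(** The test branch forces the control to be at the target, from which the idle branch gives an
    accepting run. *)
Lemma good_register_reset g t tr n : nth_error trs t = Some tr ->
  good (replace g (S (reg tr)) (Idle, n)) ->
  good (replace g (S (reg tr)) (ResetTest t, n)) ->
  good (replace g (S (reg tr)) (Done t, n)).
Proof.
  intros Ht HI HT. assert (Hi := reg_le _ _ Ht).
  apply good_active in HT; auto; [|discriminate]. destruct HT as [Hidle HT].
  apply good_idle in HI; auto. destruct HI as (p & Ep & HA).
  apply good_replace; auto. apply (pass_reset_test_inv _ _ _ _ _ _ Ht) in HT.
  assert (p = tgt tr) as -> by congruence. rewrite Ep. apply pass_done; auto.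
Qed.

(** * Interpretation of the atoms *)

Notation cl := (cl world wmul Acc).

Definition cell_world (j : nat) (s : state) (n : nat) : world := Cells [(j, (s, n))].

(** Register atoms that eat tokens contain cells of every counter value, apart from the request test
    of a zero test. The remaining ones have counter 0 and gain tokens only by multiplication. *)
Definition atom_set (a : atom) (x : world) : Prop :=
  match a with
  | AGoal => Acc x
  | AStart => x = Cells ((0, (Req start, 0)) :: map (fun i => (S i, (Idle, 0))) (seq 1 m))
  | ATok i => x = Token i
  | AIdle i => x = cell_world (S i) Idle 0
  | AIdleSig i => exists n, x = cell_world (S i) Idle n
  | ADone t => exists tr, nth_error trs t = Some tr /\
      x = cell_world (S (reg tr)) (Done t) 0
  | ADoneSig t => exists tr n, nth_error trs t = Some tr /\
      x = cell_world (S (reg tr)) (Done t) n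
  | AReqTest t => exists tr n, nth_error trs t = Some tr /\
      (op tr = KZero -> n = 0) /\ x = cell_world (S (reg tr)) (ReqTest t) n
  | AResetTest t => exists tr n, nth_error trs t = Some tr /\
      x = cell_world (S (reg tr)) (ResetTest t) n
  | AReq p => x = cell_world 0 (Req p) 0
  | ADoneTest t => x = cell_world 0 (DoneTest t) 0
  end.

Definition valuation (n : nat) (x : world) : Prop :=
  exists a, atom_index a = n /\ atom_set a x.

Notation sem := (sem world unit_world wmul Acc valuation).

Lemma sem_atom_intro a x : atom_set a x -> sem (V a) x.
Proof. intros H. apply cl_incl. exists a. auto. Qed.

Lemma sem_atom_elim a T x : (forall s, atom_set a s -> cl T s) -> sem (V a) x -> cl T x.
Proof.
  intros H Hx. apply (cl_bind _ _ _ _ _ _ Hx). intros s (a' & E & Hs).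
  apply atom_index_inj in E. subst. auto.
Qed.

Lemma sem_goal x : sem (V AGoal) x <-> Acc x.
Proof.
  split; [|apply (sem_atom_intro AGoal)]. intros H. apply (closed_Acc world wmul Acc).
  apply (sem_atom_elim AGoal); auto. intros s Hs. apply cl_incl, Hs.
Qed.

Lemma sem_of_cl a x : cl (sem a) x -> sem a x.
Proof. apply closed_sem. Qed.

Lemma sem_ldiv a b : (forall x, sem a x -> sem b x) -> sem (LDiv a b) unit_world.
Proof. intros H x Hx. rewrite wmul_unit. auto. Qed.

Lemma sem_ldiv_atom a b : (forall s, atom_set a s -> sem b s) ->
  sem (LDiv (V a) b) unit_world.
Proof.
  intros H. apply sem_ldiv. intros x Hx. apply sem_of_cl.
  apply (sem_atom_elim a); auto. intros s Hs. apply cl_incl; auto.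
Qed.

Lemma sem_ldiv_mul a a' b :
  (forall s s', atom_set a s -> atom_set a' s' -> sem b (wmul s s')) ->
  sem (LDiv (Mul (V a) (V a')) b) unit_world.
Proof.
  intros H. apply sem_ldiv. intros x Hx. apply sem_of_cl.
  apply (cl_bind _ _ _ _ _ _ Hx). intros _ (y & y' & Hy & Hy' & ->).
  apply (cl_mul _ wmul _ _ _ _ _ _ Hy Hy').
  intros s s' (c & E & Hs) (c' & E' & Hs').
  apply atom_index_inj in E, E'. subst. apply cl_incl; auto.
Qed.

(** Universal branching: a context accepting both disjuncts is described by one [k] and one [g], so
    membership in the closure of the union becomes an implication between instances of [good]. *)
Lemma sem_or_cells a b j s n sa na sb nb :
  sem a (cell_world j sa na) -> sem b (cell_world j sb nb) ->
  (forall k g, good (replace g j (sa, k + na)) -> good (replace g j (sb, k + nb)) ->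
     good (replace g j (s, k + n))) ->
  sem (Or a b) (cell_world j s n).
Proof.
  intros Ha Hb H c Hc. destruct (Acc_cell c j) as (k & g & E).
  assert (HA := Hc _ (or_introl Ha)). assert (HB := Hc _ (or_intror Hb)).
  specialize (E _ _ HA). apply E. apply H; apply E; auto.
Qed.

Lemma sem_eat_rule i a s : (forall x, atom_set a x ->
    exists n, x = cell_world (S i) s n /\ atom_set a (cell_world (S i) s (S n))) ->
  sem (eat_rule i a) unit_world.
Proof.
  intros H. apply sem_ldiv_mul. intros _ x -> Hx.
  destruct (H x Hx) as (n & -> & Hn). unfold cell_world.
  rewrite wmul_token_cell. apply sem_atom_intro, Hn.
Qed.

(** By [cl_mul], the closures in the nested product can be eliminated factor by factor, and it
    suffices to test products of elements of the atoms. *)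
Lemma sem_mul_list q l T x :
  (forall s ws, atom_set q s -> Forall2 atom_set l ws -> cl T (fold_left wmul ws s)) ->
  sem (mul_list (V q) (map V l)) x -> cl T x.
Proof.
  revert x T. induction l as [|a l IH] using rev_ind; intros x T H Hx.
  - apply (sem_atom_elim q); auto. intros s Hs. apply (H s [] Hs). constructor.
  - unfold mul_list in *. rewrite map_app, fold_left_app in Hx. simpl in Hx.
    apply (cl_bind _ _ _ _ _ _ Hx). intros _ (y & z & Hy & Hz & ->).
    assert (Hy' : cl (fun y => exists s ws, atom_set q s /\ Forall2 atom_set l ws /\
      y = fold_left wmul ws s) y).
    { apply IH; auto. intros s ws Hs Hws. apply cl_incl. eauto. }
    apply (cl_mul _ wmul _ _ _ _ _ _ Hy' Hz).
    intros _ w (s & ws & Hs & Hws & ->) (a' & E & Hw).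
    apply atom_index_inj in E. subst a'.
    specialize (H s (ws ++ [w]) Hs). rewrite fold_left_app in H. apply H.
    apply Forall2_app; auto.
Qed.

Lemma registers_perm : Permutation (0 :: map S (registers m)) (seq 0 (S (S m))).
Proof.
  change (seq 0 (S (S m))) with (0 :: seq 1 (S m)).
  apply perm_skip. rewrite <- seq_shift. apply Permutation_map.
  symmetry. apply Permutation_cons_append.
Qed.

Lemma fold_cells (P : nat -> state -> nat -> Prop) f l ws :
  (forall i w, In i l -> atom_set (f i) w ->
     exists s n, w = cell_world (S i) s n /\ P i s n) ->
  Forall2 atom_set (map f l) ws ->
  exists cells, (forall l0, fold_left wmul ws (Cells l0) = Cells (l0 ++ cells)) /\
    map fst cells = map S l /\
    forall i s n, In (S i, (s, n)) cells -> P i s n.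
Proof.
  revert ws. induction l as [|i l IH]; intros ws Hf H.
  - inversion H. subst. exists []. split; [|split; auto].
    + intros l0. rewrite app_nil_r. reflexivity.
    + contradiction.
  - inversion H as [|? w ? ws' Hw Hws]. subst.
    destruct (IH ws') as (cells & E & E' & HP); auto.
    { intros j w' Hj. apply Hf. right. exact Hj. }
    destruct (Hf i w) as (s & n & -> & Hp); simpl; auto.
    exists ((S i, (s, n)) :: cells). split; [|split].
    + intros l0.
      change (fold_left wmul ws' (wmul (Cells l0) (Cells [(S i, (s, n))])) =
        Cells (l0 ++ [(S i, (s, n))] ++ cells)).
      rewrite wmul_cells, E, <- app_assoc. reflexivity.
    + simpl. congruence.
    + intros j s' n' [[= <- <- <-]|Hin]; auto.
Qed.

(** The control cell and one cell per register fill every position exactly once, so only [good]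
    remains to be shown; [P] records what the atoms tell about each register. *)
Lemma sem_accept_rule (P : nat -> state -> nat -> Prop) q c f :
  (forall x, atom_set q x -> x = cell_world 0 c 0) ->
  (forall i w, i <= m -> atom_set (f i) w ->
     exists s n, w = cell_world (S i) s n /\ P i s n) ->
  (forall g, fst (g 0) = c ->
     (forall i, i <= m -> P i (fst (g (S i))) (snd (g (S i)))) -> good g) ->
  sem (accept_rule m q f) unit_world.
Proof.
  intros Hq Hf Hg. apply sem_ldiv. intros x Hx. apply sem_of_cl.
  rewrite <- (map_map f V) in Hx. apply (sem_mul_list q (map f (registers m))); auto.
  intros s ws Hs Hws. apply cl_incl, sem_goal. rewrite (Hq s Hs).
  destruct (fold_cells P f (registers m) ws) as (cells & E & E' & HP); auto.
  { intros i w Hi. apply Hf, in_registers, Hi. }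
  unfold cell_world. rewrite E. simpl. rewrite E'. split; [apply registers_perm|].
  apply Hg; [reflexivity|]. intros i Hi. apply HP.
  change (get ((0, (c, 0)) :: cells) (S i)) with (get cells (S i)).
  rewrite <- surjective_pairing. apply get_in. rewrite E'.
  apply in_map, in_registers, Hi.
Qed.

Lemma sem_accept_except q c i a : i <= m ->
  (forall x, atom_set q x -> x = cell_world 0 c 0) ->
  (forall w, atom_set a w -> exists s n, w = cell_world (S i) s n /\
     forall g, pass i c s n g) ->
  sem (accept_rule m q (sig_except i a)) unit_world.
Proof.
  intros Hi Hq Ha.
  (* Register [i] passes for all register values, and the others are idle. *)
  apply (sem_accept_rule (fun j s n => if j =? i then forall g, pass i c s n g else s = Idle)
    q c); auto.
  - intros j w Hj Hw. unfold sig_except in Hw. destruct (Nat.eqb_spec j i) as [->|_].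
    + apply Ha, Hw.
    + destruct Hw as [n ->]. eauto.
  - intros g Hc H. exists i. split; auto. split.
    + intros j Hj Hne. specialize (H j Hj). destruct (Nat.eqb_spec j i); tauto.
    + specialize (H i Hi). rewrite Nat.eqb_refl in H. rewrite Hc. auto.
Qed.

(** * The theory holds at the unit *)

Lemma sem_start_rule : sem (start_rule m start) unit_world.
Proof.
  apply sem_ldiv_atom. intros _ ->.
  assert (H : forall l l0, l0 <> [] ->
    forall q, sem q (Cells l0) ->
    sem (mul_list q (map (fun i => V (AIdle i)) l))
      (Cells (l0 ++ map (fun i => (S i, (Idle, 0))) l))).
  { induction l as [|i l IH]; intros l0 Hl0 q Hq; simpl.
    - rewrite app_nil_r. exact Hq.
    - change (l0 ++ (S i, (Idle, 0)) :: map (fun i => (S i, (Idle, 0))) l)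
        with (l0 ++ [(S i, (Idle, 0))] ++ map (fun i => (S i, (Idle, 0))) l).
      rewrite app_assoc. apply IH; [destruct l0; discriminate|].
      rewrite <- wmul_cells. apply cl_incl. exists (Cells l0), (cell_world (S i) Idle 0).
      split; auto. split; auto. apply (sem_atom_intro (AIdle i)). reflexivity. }
  apply (H _ [(0, (Req start, 0))]); [discriminate|].
  apply (sem_atom_intro (AReq start)). reflexivity.
Qed.

Lemma sem_register_rules i a : In a (register_rules i) -> sem a unit_world.
Proof.
  intros [<-|[<-|[]]].
  - apply sem_ldiv_atom. intros s ->. apply (sem_atom_intro (AIdleSig i)). exists 0. reflexivity.
  - apply sem_eat_rule with (s := Idle). intros x [n ->]. exists n.
    split; [reflexivity|]. exists (S n). reflexivity.
Qed.

Lemma sem_register_move t tr : nth_error trs t = Some tr ->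
  sem (match op tr with
   | KInc => LDiv (V (AIdle (reg tr)))
       (Or (Mul (V (ATok (reg tr))) (V (ADone t))) (V (AReqTest t)))
   | KDec => LDiv (Mul (V (ATok (reg tr))) (V (AIdle (reg tr))))
       (Or (V (ADone t)) (V (AReqTest t)))
   | KZero => LDiv (V (AIdle (reg tr))) (Or (V (ADone t)) (V (AReqTest t)))
   end) unit_world.
Proof.
  intros Ht.
  assert (HT : sem (V (AReqTest t)) (cell_world (S (reg tr)) (ReqTest t) 0)).
  { apply (sem_atom_intro (AReqTest t)). exists tr, 0. auto. }
  assert (HD : sem (V (ADone t)) (cell_world (S (reg tr)) (Done t) 0)).
  { apply (sem_atom_intro (ADone t)). exists tr. auto. }
  assert (Hmove := fun g => good_register_move g t tr).
  destruct (op tr).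
  - apply sem_ldiv_atom. intros _ ->. eapply sem_or_cells; [|apply HT|].
    + apply cl_incl. exists (Token (reg tr)). eexists. split; [|split; [apply HD|]].
      * apply (sem_atom_intro (ATok (reg tr))). reflexivity.
      * unfold cell_world. rewrite wmul_token_cell. reflexivity.
    (* The token multiplied to [Done t] gives counter 1 against 0 in the idle cell, so a content of
       [k] becomes [k + 1]. *)
    + intros k g. apply Hmove; auto. intros _. simpl. f_equal. lia.
  - apply sem_ldiv_mul. intros _ _ -> ->. unfold cell_world at 1. rewrite wmul_token_cell.
    eapply sem_or_cells; [apply HD|apply HT|].
    intros k g. apply Hmove; auto. intros _. rewrite Nat.add_succ_r. reflexivity.
  - apply sem_ldiv_atom. intros _ ->. eapply sem_or_cells; [apply HD|apply HT|].
    (* The test branch yields [k + 0 = 0], so the zero test may fire. *)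
    intros k g. apply Hmove; auto. intros ->; reflexivity.
Qed.

Lemma sem_trans_rules t tr a : nth_error trs t = Some tr ->
  In a (trans_rules m t tr) -> sem a unit_world.
Proof.
  intros Ht. assert (Hi := reg_le _ _ Ht).
  assert (Huniq : forall tr', nth_error trs t = Some tr' -> tr' = tr) by congruence.
  intros [<-|[<-|[<-|[<-|[<-|[<-|[<-|[<-|[<-|[<-|[]]]]]]]]]]].
  - apply sem_register_move, Ht.
  - apply sem_ldiv_atom. intros _ ->. eapply sem_or_cells.
    + apply (sem_atom_intro (AReq (tgt tr))). reflexivity.
    + apply (sem_atom_intro (ADoneTest t)). reflexivity.
    + intros k g. apply good_control_move, Ht.
  - apply sem_ldiv_atom. intros _ (tr' & Ht' & ->). rewrite (Huniq _ Ht').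
    eapply sem_or_cells.
    + apply (sem_atom_intro (AIdle (reg tr))). reflexivity.
    + apply (sem_atom_intro (AResetTest t)). exists tr, 0. auto.
    + intros k g. apply good_register_reset, Ht.
  - apply sem_ldiv_atom. intros _ (tr' & Ht' & ->).
    apply (sem_atom_intro (ADoneSig t)). exists tr', 0. auto.
  - apply sem_eat_rule with (s := Done t). intros _ (tr' & n & Ht' & ->).
    rewrite (Huniq _ Ht'). exists n. split; [reflexivity|]. exists tr, (S n). auto.
  - apply sem_eat_rule with (s := ResetTest t). intros _ (tr' & n & Ht' & ->).
    rewrite (Huniq _ Ht'). exists n. split; [reflexivity|]. exists tr, (S n). auto.
  - destruct (op tr) eqn:E; try (apply cl_incl; reflexivity);
      apply sem_eat_rule with (s := ReqTest t); intros _ (tr' & n & Ht' & _ & ->);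
      rewrite (Huniq _ Ht'); exists n; (split; [reflexivity|]); exists tr, (S n);
      (split; [auto|split; [congruence|reflexivity]]).
  - apply sem_accept_except with (c := Req (src tr)); auto.
    intros _ (tr' & n & Ht' & Hz & ->). rewrite (Huniq _ Ht') in *.
    exists (ReqTest t), n. split; auto. intros g. apply pass_req_test; auto.
  - apply sem_accept_except with (c := Req (tgt tr)); auto.
    intros _ (tr' & n & Ht' & ->). rewrite (Huniq _ Ht') in *.
    exists (ResetTest t), n. split; auto. intros g. apply pass_reset_test; auto.
  - apply sem_accept_except with (c := DoneTest t); auto.
    intros _ (tr' & n & Ht' & ->). rewrite (Huniq _ Ht') in *.
    exists (Done t), n. split; auto. intros g. apply pass_done_test; auto.
Qed.

Lemma sem_theory a : In a (theory trs m start halt) -> sem a unit_world.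
Proof.
  intros H. apply in_theory in H.
  destruct H as [->|[->|[(i & _ & H)|(t & tr & Ht & H)]]].
  - apply sem_start_rule.
  - apply (sem_accept_rule (fun _ s _ => s = Idle) _ (Req halt)); auto.
    + intros i _ _ [n ->]. eauto.
    (* All registers are idle, so any of them can be the witness. *)
    + intros g Hc H. exists 0. split; [lia|]. split.
      * intros j Hj _. auto.
      * rewrite Hc, (H 0) by lia. apply pass_idle, accepting_halt.
  - eapply sem_register_rules, H.
  - eapply sem_trans_rules; eauto.
Qed.

Lemma sem_big_and l : (forall a, In a l -> sem a unit_world) -> sem (big_and l) unit_world.
Proof.
  induction l as [|a l IH]; intros H.
  - apply cl_incl. reflexivity.
  - split; [apply H; left; reflexivity|]. apply IH. intros b Hb. apply H. right. exact Hb.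
Qed.

Lemma get_initial n l j : ~ In 0 l ->
  get (map (fun i => (S i, (Idle, 0))) l ++ [(1, (Idle, n))]) (S j) =
  (Idle, if j =? 0 then n else 0).
Proof.
  unfold get. induction l as [|i l IH]; intros H; simpl.
  - destruct j; reflexivity.
  - destruct (Nat.eqb_spec i j) as [->|]; simpl.
    + destruct j; [destruct H; left|]; reflexivity.
    + apply IH. intros H0. apply H. right. exact H0.
Qed.

(** Validity is evaluated at the world of the initial configuration. It is accepted and all its
    registers are idle, so only [pass_idle] is possible, which contains the run. *)
Theorem derives_initial_accepting R n :
  derives R (theory trs m start halt) (V AGoal) (initial_tree n) ->
  accepting start (snd (init n)).
Proof.
  intros H.
  assert (Hv := prov_valid world unit_world wmul unit_wmul wmul_unit Acc
    Acc_exchange Acc_contraction valuation R _ _ H).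
  assert (Htheory : sem (Bang (big_and (theory trs m start halt))) unit_world).
  { apply cl_incl. split; [reflexivity|]. apply sem_big_and, sem_theory. }
  set (s := Cells ((0, (Req start, 0)) :: map (fun i => (S i, (Idle, 0))) (seq 1 m))) in *.
  assert (Hcomb : sem_st world unit_world wmul Acc valuation
    (comb 0 n (F (V (AIdle 0)))) (cell_world 1 Idle n)).
  { clear. induction n as [|n IH].
    - apply (sem_atom_intro (AIdle 0)). reflexivity.
    - change (comb 0 (S n) (F (V (AIdle 0))))
        with (comp (F (V (ATok 0))) (comb 0 n (F (V (AIdle 0))))).
      replace (cell_world 1 Idle (S n)) with (wmul (Token 0) (cell_world 1 Idle n))
        by apply wmul_token_cell.
      apply sem_comp_mul; auto using unit_wmul, wmul_unit.
      apply (sem_atom_intro (ATok 0)). reflexivity. }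
  assert (HA : Acc (wmul unit_world (wmul s (cell_world 1 Idle n)))).
  { apply sem_goal. apply (Hv (wmul unit_world (wmul s (cell_world 1 Idle n)))).
    apply sem_comp_mul; auto using unit_wmul, wmul_unit.
    apply sem_comp_mul; auto using unit_wmul, wmul_unit.
    apply (sem_atom_intro AStart). reflexivity. }
  unfold s, cell_world in HA. rewrite unit_wmul, wmul_cells in HA.
  destruct HA as [_ (i & _ & _ & Hp)].
  set (l := ((0, (Req start, 0)) :: map (fun i => (S i, (Idle, 0))) (seq 1 m)) ++
    [(1, (Idle, n))]) in *.
  assert (E : forall j, get l (S j) = (Idle, if j =? 0 then n else 0)).
  { intros j. unfold l. simpl. rewrite <- (get_initial n (seq 1 m) j); [reflexivity|].
    rewrite in_seq. lia. }
  rewrite E in Hp. change (fst (get l 0)) with (Req start) in Hp. simpl in Hp.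
  inversion Hp as [i' p n' g HA| | | |]; subst.
  replace (snd (init n)) with (fun j => snd (get l (S j))); auto.
  apply functional_extensionality. intros j. rewrite E. reflexivity.
Qed.

End Model.

(** * Counter machines and diagonalisation *)

Definition halts (P : program) (c : config) : Prop :=
  exists k, halted P (Nat.iter k (step P) c).

Definition reaches (P : program) (c c' : config) : Prop :=
  exists k, Nat.iter k (step P) c = c'.

Lemma reaches_refl P c : reaches P c c.
Proof. exists 0. reflexivity. Qed.

Lemma reaches_trans P c c' c'' : reaches P c c' -> reaches P c' c'' -> reaches P c c''.
Proof. intros [k <-] [k' <-]. exists (k' + k). apply Nat.iter_add. Qed.

Lemma reaches_step P c c' : step P c = c' -> reaches P c c'.
Proof. intros <-. exists 1. reflexivity. Qed.

Lemma step_halted P c : halted P c -> step P c = c.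
Proof.
  destruct c as [pc g]. unfold halted, step. simpl. intros H.
  apply nth_error_None in H. rewrite H. reflexivity.
Qed.

Lemma iter_fixed {A : Type} (f : A -> A) x k : f x = x -> Nat.iter k f x = x.
Proof. intros H. induction k; simpl; congruence. Qed.

(** Halted configurations are fixed points of [step], so a run continued past its halting time stays
    halted. *)
Lemma reaches_halts P c c' : reaches P c c' -> halts P c <-> halts P c'.
Proof.
  intros [k <-]. split; intros [k' H].
  - exists k'. rewrite <- Nat.iter_add, Nat.add_comm, Nat.iter_add.
    rewrite (iter_fixed _ _ k); auto using step_halted.
  - exists (k' + k). rewrite Nat.iter_add. exact H.
Qed.

Lemma upd_same g r : upd g r (g r) = g.
Proof.
  apply functional_extensionality. intros i. unfold upd.
  destruct (Nat.eqb_spec i r); congruence.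
Qed.

(** * Counter machines as transition systems *)

(** A program halts at any address beyond its end; the minimum merges these addresses into the
    single halting state [h]. *)
Definition trans_of_instr (h p : nat) (ins : instr) : list trans :=
  match ins with
  | INC r => [Trans p r KInc (min (S p) h)]
  | DEC r j => [Trans p r KDec (min (S p) h); Trans p r KZero (min j h)]
  end.

Definition transitions (P : program) : list trans :=
  flat_map (fun p => match nth_error P p with
                     | Some ins => trans_of_instr (length P) p ins
                     | None => []
                     end) (seq 0 (length P)).

Lemma in_transitions P tr : In tr (transitions P) <->
  exists p ins, nth_error P p = Some ins /\ In tr (trans_of_instr (length P) p ins).
Proof.
  unfold transitions. rewrite in_flat_map. split.
  - intros (p & _ & H). destruct (nth_error P p) as [ins|] eqn:E; [eauto|contradiction].
  - intros (p & ins & E & H). exists p. rewrite E. split; auto.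
    apply in_seq. assert (p < length P) by (apply nth_error_Some; congruence). lia.
Qed.

Lemma accepting_in trs h tr g n : In tr trs -> fire (op tr) (g (reg tr)) = Some n ->
  accepting trs h (tgt tr) (upd g (reg tr) n) -> accepting trs h (src tr) g.
Proof.
  intros Hin Hn. apply In_nth_error in Hin. destruct Hin as [t Ht].
  apply (accepting_step _ _ _ _ _ _ Ht Hn).
Qed.

Lemma halts_clip P q g : halts P (min q (length P), g) -> halts P (q, g).
Proof.
  destruct (Nat.le_gt_cases (length P) q) as [H|H].
  - intros _. exists 0. exact H.
  - rewrite Nat.min_l by lia. auto.
Qed.

(** The two transitions of a [DEC] exclude each other, so an accepting run is the deterministic run
    of the program. *)
Lemma accepting_halts P p g : accepting (transitions P) (length P) p g -> halts P (p, g).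
Proof.
  induction 1 as [g|t tr g n Ht Hn _ IH].
  - exists 0. apply le_n.
  - apply nth_error_In, in_transitions in Ht. destruct Ht as (p & ins & E & Hin).
    apply (reaches_halts P _ (step P (src tr, g))); [apply reaches_step; reflexivity|].
    destruct ins as [r|r j]; simpl in Hin.
    + destruct Hin as [<-|[]]. simpl in *. rewrite E. injection Hn as <-.
      apply halts_clip, IH.
    + destruct Hin as [<-|[<-|[]]]; simpl in *; rewrite E.
      * destruct (g r) as [|v] eqn:Eg; [discriminate|]. injection Hn as <-.
        apply halts_clip, IH.
      * destruct (g r) as [|v] eqn:Eg; [|discriminate]. injection Hn as <-.
        rewrite <- Eg, upd_same in IH. apply halts_clip, IH.
Qed.

Lemma halts_accepting P p g : halts P (p, g) ->
  accepting (transitions P) (length P) (min p (length P)) g.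
Proof.
  intros [k H]. revert p g H. induction k as [|k IH]; intros p g H.
  - rewrite Nat.min_r by exact H. constructor.
  - rewrite Nat.iter_succ_r in H.
    destruct (Nat.le_gt_cases (length P) p) as [Hp|Hp].
    + rewrite Nat.min_r by exact Hp. constructor.
    + rewrite Nat.min_l by lia.
      destruct (nth_error P p) as [ins|] eqn:E; [|apply nth_error_None in E; lia].
      assert (Hin : forall tr, In tr (trans_of_instr (length P) p ins) -> In tr (transitions P)).
      { intros tr Htr. apply in_transitions. eauto. }
      unfold step in H at 2. rewrite E in H. destruct ins as [r|r j].
      * apply IH in H.
        apply (accepting_in _ _ (Trans p r KInc (min (S p) (length P))) g (S (g r)));
          auto. apply Hin. left. reflexivity.
      * destruct (g r) as [|v] eqn:Eg; apply IH in H.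
        -- apply (accepting_in _ _ (Trans p r KZero (min j (length P))) g 0).
           ++ apply Hin. right. left. reflexivity.
           ++ simpl. rewrite Eg. reflexivity.
           ++ simpl. rewrite <- Eg, upd_same. exact H.
        -- apply (accepting_in _ _ (Trans p r KDec (min (S p) (length P))) g v); auto.
           ++ apply Hin. left. reflexivity.
           ++ simpl. rewrite Eg. reflexivity.
Qed.

(** * A loop language and its compilation *)

Inductive cmd : Type :=
| CInc (r : nat)
| CSeq (c d : cmd)
| CLoop (r : nat) (c : cmd).

(* Register 6 is kept at 0, so that [DEC 6 j] is an unconditional jump. *)
Fixpoint compile (off : nat) (c : cmd) : program :=
  match c with
  | CInc r => [INC r]
  | CSeq c d => let l := compile off c in l ++ compile (off + length l) d
  | CLoop r c =>
      let l := compile (S off) c in DEC r (off + length l + 2) :: l ++ [DEC 6 off]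
  end.

(** The loop tests and decrements [r] before each round, and its body may change [r] again. The
    premise on register 6 makes the backward jump succeed. *)
Inductive exec : cmd -> (nat -> nat) -> (nat -> nat) -> Prop :=
| exec_inc r g : exec (CInc r) g (upd g r (S (g r)))
| exec_seq c d g g' g'' : exec c g g' -> exec d g' g'' -> exec (CSeq c d) g g''
| exec_loop_zero r c g : g r = 0 -> exec (CLoop r c) g g
| exec_loop_succ r c g v g' g'' : g r = S v -> exec c (upd g r v) g' -> g' 6 = 0 ->
    exec (CLoop r c) g' g'' -> exec (CLoop r c) g g''.

Lemma nth_error_middle {A : Type} (l1 l2 : list A) x :
  nth_error (l1 ++ x :: l2) (length l1) = Some x.
Proof. rewrite nth_error_app2, Nat.sub_diag by lia. reflexivity. Qed.

(** Compiled jumps are absolute, so the offset must be the length of the preceding code; the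
    surrounding code is arbitrary to let the induction pass to subcommands. *)
Lemma exec_reaches c g g' : exec c g g' -> forall l1 l2,
  let l := compile (length l1) c in
  reaches (l1 ++ l ++ l2) (length l1, g) (length l1 + length l, g').
Proof.
  induction 1 as [r g|c d g g' g'' _ IH1 _ IH2|r c g Hz|r c g v g' g'' Hs _ IH1 Hz _ IH2];
    intros l1 l2; cbn [compile]; cbv zeta.
  - apply reaches_step. unfold step. simpl. rewrite nth_error_middle, Nat.add_1_r. reflexivity.
  - specialize (IH1 l1). cbv zeta in IH1. set (l := compile (length l1) c) in *.
    specialize (IH2 (l1 ++ l)). cbv zeta in IH2. rewrite length_app in IH2.
    set (l' := compile (length l1 + length l) d) in *.
    apply (reaches_trans _ _ (length l1 + length l, g')).
    + rewrite <- (app_assoc l). apply IH1.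
    + rewrite length_app, Nat.add_assoc, <- (app_assoc l), (app_assoc l1). apply IH2.
  - set (l := compile (S (length l1)) c). apply reaches_step. unfold step. simpl.
    rewrite nth_error_middle, Hz, length_app. simpl. f_equal. lia.
  - specialize (IH2 l1 l2). cbn [compile] in IH2. cbv zeta in IH2.
    set (l := compile (S (length l1)) c) in *.
    set (ins := DEC r (length l1 + length l + 2)) in *.
    specialize (IH1 (l1 ++ [ins])). cbv zeta in IH1. rewrite length_app in IH1.
    simpl in IH1. rewrite Nat.add_1_r in IH1. fold l in IH1.
    apply (reaches_trans _ _ (S (length l1), upd g r v)).
    { apply reaches_step. unfold step. simpl. rewrite nth_error_middle.
      unfold ins. rewrite Hs. reflexivity. }
    apply (reaches_trans _ _ (S (length l1) + length l, g')).
    { specialize (IH1 ([DEC 6 (length l1)] ++ l2)). rewrite <- app_assoc in IH1.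
      simpl. rewrite <- app_assoc. exact IH1. }
    apply (reaches_trans _ _ (length l1, g')); [|exact IH2].
    apply reaches_step. unfold step.
    replace (l1 ++ (ins :: l ++ [DEC 6 (length l1)]) ++ l2)
      with ((l1 ++ ins :: l) ++ DEC 6 (length l1) :: l2)
      by (simpl; rewrite <- !app_assoc; simpl; rewrite <- ?app_assoc; reflexivity).
    replace (S (length l1) + length l) with (length (l1 ++ ins :: l))
      by (rewrite length_app; simpl; lia).
    rewrite nth_error_middle, Hz. reflexivity.
Qed.

Definition env (a0 a1 a2 a3 a4 a5 : nat) (i : nat) : nat :=
  match i with 0 => a0 | 1 => a1 | 2 => a2 | 3 => a3 | 4 => a4 | 5 => a5 | _ => 0 end.

Ltac env_ext :=
  apply functional_extensionality; intros [|[|[|[|[|[|?]]]]]];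
  unfold upd; simpl; lia.

Lemma exec_inc_eq r g g' : g' = upd g r (S (g r)) -> exec (CInc r) g g'.
Proof. intros ->. constructor. Qed.

Lemma exec_move r s g g' : r <> s -> r <> 6 -> s <> 6 -> g 6 = 0 ->
  g' = upd (upd g s (g r + g s)) r 0 -> exec (CLoop r (CInc s)) g g'.
Proof.
  intros Hrs Hr Hs. remember (g r) as n eqn:E. revert g E.
  induction n as [|n IH]; intros g E Hz ->.
  - replace (upd _ r 0) with g; [apply exec_loop_zero; auto|].
    simpl. rewrite upd_same, E. symmetry. apply upd_same.
  - apply (exec_loop_succ _ _ _ n (upd (upd g r n) s (S (g s)))); auto.
    + apply exec_inc_eq. f_equal. unfold upd.
      destruct (Nat.eqb_spec s r); congruence.
    + unfold upd. destruct (Nat.eqb_spec 6 s), (Nat.eqb_spec 6 r); congruence.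
    + apply IH.
      * unfold upd. rewrite Nat.eqb_refl. destruct (Nat.eqb_spec r s); congruence.
      * unfold upd. destruct (Nat.eqb_spec 6 s), (Nat.eqb_spec 6 r); congruence.
      * apply functional_extensionality. intros i. unfold upd. rewrite Nat.eqb_refl.
        destruct (Nat.eqb_spec i r), (Nat.eqb_spec i s); lia.
Qed.

Definition incs (r n : nat) (c : cmd) : cmd := Nat.iter n (CSeq (CInc r)) c.

Lemma exec_incs r n c g g' : exec c (upd g r (n + g r)) g' -> exec (incs r n c) g g'.
Proof.
  revert g. induction n as [|n IH]; intros g H; simpl.
  - simpl in H. rewrite upd_same in H. exact H.
  - eapply exec_seq; [constructor|]. apply IH.
    replace (upd _ r _) with (upd g r (S n + g r)); auto.
    apply functional_extensionality. intros i. unfold upd.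
    rewrite Nat.eqb_refl. destruct (i =? r); lia.
Qed.

(** * Computing codes *)

(** Cantor pairing of registers 1 and 2 into register 3. The first loop adds [b] to registers 1 and
    3; the second adds [s + (s - 1) + ... + 1] for [s = a + b], with register 4 restoring the
    counter after each round. *)
Definition pair_cmd : cmd :=
  CSeq (CLoop 2 (CSeq (CInc 1) (CInc 3)))
    (CLoop 1 (CSeq (CInc 3)
      (CSeq (CLoop 1 (CSeq (CInc 4) (CInc 3))) (CLoop 4 (CInc 1))))).

Lemma cpair_0_r s : cpair (S s) 0 = S s + cpair s 0.
Proof.
  unfold cpair. rewrite !Nat.add_0_r.
  replace (S s * (S s + 1)) with (s * (s + 1) + S s * 2) by lia.
  rewrite Nat.div_add by lia. lia.
Qed.

Lemma cpair_split a b : cpair a b = cpair (a + b) 0 + b.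
Proof. unfold cpair. rewrite !Nat.add_0_r. reflexivity. Qed.

Lemma exec_pair a b x y : exec pair_cmd (env x a b 0 0 y) (env x 0 0 (cpair a b) 0 y).
Proof.
  assert (H1 : forall b a r, exec (CLoop 2 (CSeq (CInc 1) (CInc 3)))
    (env x a b r 0 y) (env x (a + b) 0 (b + r) 0 y)).
  { clear a b. induction b as [|b IH]; intros a r.
    - rewrite Nat.add_0_r. apply exec_loop_zero. reflexivity.
    - apply (exec_loop_succ _ _ _ b (env x (S a) b (S r) 0 y)); [reflexivity| |reflexivity|].
      + apply (exec_seq _ _ _ (env x (S a) b r 0 y)); apply exec_inc_eq; env_ext.
      + replace (a + S b) with (S a + b) by lia. replace (S b + r) with (b + S r) by lia.
        apply IH. }
  assert (H2 : forall s r c, exec (CLoop 1 (CSeq (CInc 4) (CInc 3)))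
    (env x s 0 r c y) (env x 0 0 (s + r) (s + c) y)).
  { induction s as [|s IH]; intros r c.
    - apply exec_loop_zero. reflexivity.
    - apply (exec_loop_succ _ _ _ s (env x s 0 (S r) (S c) y)); [reflexivity| |reflexivity|].
      + apply (exec_seq _ _ _ (env x s 0 r (S c) y)); apply exec_inc_eq; env_ext.
      + replace (S s + r) with (s + S r) by lia. replace (S s + c) with (s + S c) by lia.
        apply IH. }
  assert (H3 : forall s r, exec (CLoop 1 (CSeq (CInc 3)
      (CSeq (CLoop 1 (CSeq (CInc 4) (CInc 3))) (CLoop 4 (CInc 1)))))
    (env x s 0 r 0 y) (env x 0 0 (cpair s 0 + r) 0 y)).
  { induction s as [|s IH]; intros r.
    - apply exec_loop_zero. reflexivity.
    - apply (exec_loop_succ _ _ _ s (env x s 0 (s + S r) 0 y)); [reflexivity| |reflexivity|].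
      + apply (exec_seq _ _ _ (env x s 0 (S r) 0 y)); [apply exec_inc_eq; env_ext|].
        eapply exec_seq; [apply H2|]. apply exec_move; auto. env_ext.
      + rewrite cpair_0_r. replace (S s + cpair s 0 + r) with (cpair s 0 + (s + S r)) by lia.
        apply IH. }
  eapply exec_seq; [apply H1|]. rewrite cpair_split, Nat.add_0_r. apply H3.
Qed.

Definition wrap_cmd (c : nat) : cmd := CSeq (CLoop 3 (CInc 2)) (incs 1 c pair_cmd).

Lemma exec_wrap c x r y : exec (wrap_cmd c) (env x 0 0 r 0 y) (env x 0 0 (cpair c r) 0 y).
Proof.
  apply (exec_seq _ _ _ (env x 0 r 0 0 y)); [apply exec_move; auto; env_ext|].
  apply exec_incs. replace (upd _ 1 _) with (env x c r 0 0 y) by env_ext.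
  apply exec_pair.
Qed.

Definition atom_code (a : atom) : nat := code_tree (Leaf (V a)).

(** A [Node] is coded by two nested pairs with constant first components, so each token costs two
    calls of [wrap_cmd], from the innermost leaf outwards. *)
Definition numeral_cmd : cmd :=
  CLoop 0 (CSeq (wrap_cmd (atom_code (ATok 0))) (wrap_cmd 1)).

Fixpoint numeral_tree (n : nat) : tree :=
  match n with
  | 0 => Leaf (V (AIdle 0))
  | S n => Node (Leaf (V (ATok 0))) (numeral_tree n)
  end.

Lemma comb_numeral n : comb 0 n (F (V (AIdle 0))) = Some (numeral_tree n).
Proof. induction n as [|n IH]; [reflexivity|]. unfold comb in *. simpl. rewrite IH. reflexivity. Qed.

Lemma exec_numeral n k y : exec numeral_cmd
  (env n 0 0 (code_tree (numeral_tree k)) 0 y)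
  (env 0 0 0 (code_tree (numeral_tree (n + k))) 0 y).
Proof.
  revert k. induction n as [|n IH]; intros k.
  - apply exec_loop_zero. reflexivity.
  - apply (exec_loop_succ _ _ _ n (env n 0 0 (code_tree (numeral_tree (S k))) 0 y));
      [reflexivity| |reflexivity|].
    + replace (upd _ 0 n) with (env n 0 0 (code_tree (numeral_tree k)) 0 y) by env_ext.
      eapply exec_seq; apply exec_wrap.
    + replace (S n + k) with (n + S k) by lia. apply IH.
Qed.

(** * The diagonal sequent and its code *)

Definition diagonal_sequent (a : fm) : sequent :=
  (comp (F a) (initial_tree (code_fm a)), Some (V AGoal)).

(** Register 5 keeps a copy of the input while the code of the initial tree is built in register 3.
    The copy is then paired with 0 to code the leaf of the formula, and the code of the whole
    sequent ends in register 0. *)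
Definition diagonal_cmd : cmd :=
  CSeq (CLoop 0 (CSeq (CInc 1) (CInc 5)))
  (CSeq (CLoop 1 (CInc 0))
  (CSeq (incs 3 (atom_code (AIdle 0)) numeral_cmd)
  (CSeq (wrap_cmd (atom_code AStart))
  (CSeq (wrap_cmd 1)
  (CSeq (CLoop 3 (CInc 0))
  (CSeq (CLoop 5 (CInc 2))
  (CSeq pair_cmd
  (CSeq (CLoop 3 (CInc 1))
  (CSeq (CLoop 0 (CInc 2))
  (CSeq pair_cmd
  (CSeq (wrap_cmd 1)
  (CSeq (CInc 3)
  (CSeq (CLoop 3 (CInc 1))
  (CSeq (incs 2 (S (code_fm (V AGoal))) pair_cmd)
  (CLoop 3 (CInc 0)))))))))))))))).

Lemma init_env n : snd (init n) = env n 0 0 0 0 0.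
Proof. apply functional_extensionality. intros [|[|[|[|[|[|i]]]]]]; reflexivity. Qed.

Lemma exec_copy n x y : exec (CLoop 0 (CSeq (CInc 1) (CInc 5)))
  (env n x 0 0 0 y) (env 0 (n + x) 0 0 0 (n + y)).
Proof.
  revert x y. induction n as [|n IH]; intros x y.
  - apply exec_loop_zero. reflexivity.
  - apply (exec_loop_succ _ _ _ n (env n (S x) 0 0 0 (S y))); [reflexivity| |reflexivity|].
    + apply (exec_seq _ _ _ (env n (S x) 0 0 0 y)); apply exec_inc_eq; env_ext.
    + replace (S n + x) with (n + S x) by lia. replace (S n + y) with (n + S y) by lia.
      apply IH.
Qed.

Lemma code_diagonal_sequent a : code_seq (diagonal_sequent a) =
  cpair (S (cpair 1 (cpair (cpair 0 (code_fm a))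
    (cpair 1 (cpair (atom_code AStart) (code_tree (numeral_tree (code_fm a))))))))
    (S (code_fm (V AGoal))).
Proof.
  unfold diagonal_sequent, initial_tree. rewrite comb_numeral. reflexivity.
Qed.

Lemma exec_diagonal a : exec diagonal_cmd
  (snd (init (code_fm a))) (snd (init (code_seq (diagonal_sequent a)))).
Proof.
  rewrite !init_env, code_diagonal_sequent. generalize (code_fm a) as n. intros n.
  set (t := cpair 1 (cpair (atom_code AStart) (code_tree (numeral_tree n)))).
  set (t' := cpair (cpair 0 n) t).
  unfold diagonal_cmd.
  eapply exec_seq; [apply exec_copy|]. rewrite Nat.add_0_r.
  apply (exec_seq _ _ _ (env n 0 0 0 0 n)); [apply exec_move; auto; env_ext|].
  apply (exec_seq _ _ _ (env 0 0 0 (code_tree (numeral_tree n)) 0 n)).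
  { apply exec_incs.
    replace (upd _ 3 _) with (env n 0 0 (code_tree (numeral_tree 0)) 0 n).
    - assert (H := exec_numeral n 0 n). rewrite Nat.add_0_r in H. exact H.
    - change (code_tree (numeral_tree 0)) with (atom_code (AIdle 0)).
      generalize (atom_code (AIdle 0)) as c. intros c. env_ext. }
  eapply exec_seq; [apply exec_wrap|]. eapply exec_seq; [apply exec_wrap|]. fold t.
  apply (exec_seq _ _ _ (env t 0 0 0 0 n)); [apply exec_move; auto; env_ext|].
  apply (exec_seq _ _ _ (env t 0 n 0 0 0)); [apply exec_move; auto; env_ext|].
  eapply exec_seq; [apply exec_pair|].
  apply (exec_seq _ _ _ (env t (cpair 0 n) 0 0 0 0)); [apply exec_move; auto; env_ext|].
  apply (exec_seq _ _ _ (env 0 (cpair 0 n) t 0 0 0)); [apply exec_move; auto; env_ext|].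
  eapply exec_seq; [apply exec_pair|]. fold t'.
  eapply exec_seq; [apply exec_wrap|].
  generalize (cpair 1 t') as w, (code_fm (V AGoal)) as c. intros w c.
  apply (exec_seq _ _ _ (env 0 0 0 (S w) 0 0)); [apply exec_inc_eq; env_ext|].
  apply (exec_seq _ _ _ (env 0 (S w) 0 0 0 0)); [apply exec_move; auto; env_ext|].
  apply (exec_seq _ _ _ (env 0 0 0 (cpair (S w) (S c)) 0 0)).
  { apply exec_incs.
    replace (upd _ 2 _) with (env 0 (S w) (S c) 0 0 0) by env_ext.
    apply exec_pair. }
  apply exec_move; auto. env_ext.
Qed.

(** * Running the decider and inverting its answer *)

(** Jump targets are clipped so that every way of halting leads to the first instruction after the
    relocated copy. *)
Definition shift_instr (off h : nat) (ins : instr) : instr :=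
  match ins with
  | INC r => INC r
  | DEC r j => DEC r (off + min j h)
  end.

Lemma shifted_reaches P l1 l2 g k :
  let c := Nat.iter k (step P) (0, g) in
  reaches (l1 ++ map (shift_instr (length l1) (length P)) P ++ l2)
    (length l1, g) (length l1 + min (fst c) (length P), snd c).
Proof.
  cbv zeta. induction k as [|k IH].
  - simpl. rewrite Nat.add_0_r. apply reaches_refl.
  - apply (reaches_trans _ _ _ _ IH). simpl.
    destruct (Nat.iter k (step P) (0, g)) as [pc f]. simpl.
    destruct (nth_error P pc) as [ins|] eqn:E; [|apply reaches_refl].
    assert (Hpc : pc < length P) by (apply nth_error_Some; congruence).
    rewrite (Nat.min_l pc) by lia. apply reaches_step. unfold step.
    rewrite nth_error_app2, Nat.add_comm, Nat.add_sub by lia.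
    rewrite nth_error_app1 by (rewrite length_map; lia).
    rewrite nth_error_map, E. cbn [option_map].
    destruct ins as [r|r j]; cbn [shift_instr]; [|destruct (f r)]; cbn [fst snd];
      rewrite ?(Nat.min_l (S pc)) by lia; f_equal; lia.
Qed.

Definition answer_pc (c : cmd) (P : program) : nat := length (compile 0 c) + length P.

(* Halts if and only if [P] answers 0 on the number computed by [c]. *)
Definition flip_program (c : cmd) (P : program) : program :=
  let l := compile 0 c in
  l ++ map (shift_instr (length l) (length P)) P ++
    [DEC 0 (answer_pc c P + 2); DEC 0 (answer_pc c P + 1)].

Lemma flip_program_instr c P i ins :
  nth_error [DEC 0 (answer_pc c P + 2); DEC 0 (answer_pc c P + 1)] i = Some ins ->
  nth_error (flip_program c P) (answer_pc c P + i) = Some ins.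
Proof.
  intros H. unfold flip_program. cbv zeta.
  rewrite app_assoc, nth_error_app2; rewrite length_app, length_map;
    fold (answer_pc c P); [|lia].
  rewrite <- H. f_equal. lia.
Qed.

Lemma length_flip_program c P : length (flip_program c P) = answer_pc c P + 2.
Proof.
  unfold flip_program. cbv zeta. rewrite !length_app, length_map.
  rewrite Nat.add_assoc. reflexivity.
Qed.

Lemma flip_program_reaches c P n n' v : exec c (snd (init n)) (snd (init n')) ->
  computes P n' v ->
  exists g, g 0 = v /\ reaches (flip_program c P) (init n) (answer_pc c P, g).
Proof.
  intros Hc (k & Hh & Hv). eexists. split; [exact Hv|].
  set (l := compile 0 c).
  apply (reaches_trans _ _ (length l, snd (init n'))).
  - apply (exec_reaches _ _ _ Hc []).
  - assert (H := shifted_reaches P l [DEC 0 (answer_pc c P + 2); DEC 0 (answer_pc c P + 1)]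
      (snd (init n')) k).
    cbv zeta in H. rewrite Nat.min_r in H by exact Hh. exact H.
Qed.

Lemma flip_program_halts c P n n' : exec c (snd (init n)) (snd (init n')) ->
  computes P n' 0 -> halts (flip_program c P) (init n).
Proof.
  intros Hc H. destruct (flip_program_reaches _ _ _ _ _ Hc H) as (g & Hg & Hr).
  apply (reaches_halts _ _ _ Hr). apply (reaches_halts _ _ (answer_pc c P + 2, g)).
  - apply reaches_step. unfold step. rewrite <- (Nat.add_0_r (answer_pc c P)) at 1.
    rewrite (flip_program_instr c P 0 _ eq_refl), Hg. reflexivity.
  - exists 0. unfold halted. rewrite length_flip_program. apply le_n.
Qed.

(** The first of the two last instructions lowers the answer 1 to 0; the second then jumps to
    itself, a fixed point that is not halted. *)
Lemma flip_program_loops c P n n' : exec c (snd (init n)) (snd (init n')) ->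
  computes P n' 1 -> ~ halts (flip_program c P) (init n).
Proof.
  intros Hc H Hh. destruct (flip_program_reaches _ _ _ _ _ Hc H) as (g & Hg & Hr).
  apply (reaches_halts _ _ _ Hr) in Hh.
  apply (reaches_halts _ _ (answer_pc c P + 1, upd g 0 0)) in Hh.
  - destruct Hh as [k Hk]. rewrite iter_fixed in Hk.
    + unfold halted in Hk. rewrite length_flip_program in Hk. simpl in Hk. lia.
    + unfold step. rewrite (flip_program_instr c P 1 _ eq_refl). reflexivity.
  - apply reaches_step. unfold step. rewrite <- (Nat.add_0_r (answer_pc c P)) at 1.
    rewrite (flip_program_instr c P 0 _ eq_refl), Hg. f_equal. lia.
Qed.

(** * Diagonalisation *)

Definition program_formula (P : program) : fm :=
  Bang (big_and (theory (transitions P) (list_max (map reg (transitions P))) 0 (length P))).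

Lemma prov_program_formula R P n :
  prov R (comp (F (program_formula P)) (initial_tree n)) (Some (V AGoal)) <->
  halts P (init n).
Proof.
  assert (Hm : forall t tr, nth_error (transitions P) t = Some tr ->
    reg tr <= list_max (map reg (transitions P))).
  { intros t tr Ht. apply nth_error_In, (in_map reg) in Ht.
    assert (H := proj1 (list_max_le _ _) (le_n (list_max (map reg (transitions P))))).
    rewrite Forall_forall in H. auto. }
  split; intros H.
  - apply (accepting_halts P 0). exact (derives_initial_accepting _ _ _ _ Hm R n H).
  - apply (halts_accepting P 0) in H.
    exact (accepting_derives_initial _ _ _ _ Hm R n H).
Qed.

Lemma provable_diagonal_sequent R P :
  provable R (diagonal_sequent (program_formula P)) <->
  halts P (init (code_fm (program_formula P))).
Proof.
  unfold provable, diagonal_sequent. cbn [fst snd].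
  generalize (code_fm (program_formula P)) as n. apply prov_program_formula.
Qed.

Theorem mainTheorem3 (R : srule -> Prop) :
  ~ exists P : program, decides P (provable R).
Proof.
  intros [P HP].
  assert (E := provable_diagonal_sequent R (flip_program diagonal_cmd P)).
  revert E. generalize (program_formula (flip_program diagonal_cmd P)) as a. intros a E.
  destruct (HP (diagonal_sequent a)) as [Hyes Hno].
  (* If the sequent were provable, the answer 1 would make the diagonal program loop, against [E].
     Unprovability, thus established without excluded middle, makes it halt and hence the sequent
     provable. *)
  assert (Hn : ~ provable R (diagonal_sequent a)).
  { intros H. apply (flip_program_loops _ P _ _ (exec_diagonal a) (Hyes H)), E, H. }
  apply Hn, E, (flip_program_halts _ P _ _ (exec_diagonal a)), Hno, Hn.
Qed.
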